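(* Consider the random $2$-dimensional complex process $\{Y(n,M)\}_{0\le M\le\binom{n}{3}}$. Let $M_1=\min\{M: Y(n,M)\text{ has no isolated edge}\}$ and $M_3=\min\{M: H^1(Y(n,M),\mathbb{Z}/2)=0\}$. Then $\mathbb{P}(M_1=M_3)\to 1$ as $n\to\infty$; that is, with probability tending to 1, the triangle that eliminates the chronologically last isolated edge also makes $H^1(Y,\mathbb{Z}/2)=0$.
   Context: $Y(n,0)$ is the complete graph on $[n]$ viewed as a $1$-dimensional simplicial complex (all vertices and all edges, no triangles). For $M\ge1$, $Y(n,M)$ is obtained from $Y(n,M-1)$ by adding a triangle (3-element subset of $[n]$) chosen uniformly at random among the $\binom{n}{3}-(M-1)$ triangles not yet present. An edge is isolated if it is contained in no triangle of the complex. $H^1(\cdot,\mathbb{Z}/2)$ denotes simplicial cohomology with $\mathbb{Z}/2$ coefficients: with $C^j$ the functions from $j$-faces to $\mathbb{Z}/2$ and $d_jf(\sigma)=\sum_{\tau\subset\sigma,|\tau|=|\sigma|-1}f(\tau)$, $H^1=\ker d_1/\operatorname{im}d_0$. *)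

(* Defs.v *)
From HB Require Import structures.
From mathcomp Require Import all_boot all_order all_algebra all_fingroup.

Set Implicit Arguments.
Unset Strict Implicit.
Unset Printing Implicit Defensive.

Import GRing.Theory.
Local Open Scope ring_scope.

(* A simplicial complex on the vertex set 'I_n is given by its set K of
   nonempty faces; a j-face has j.+1 vertices. *)
Section Cohomology.
Variables (n : nat) (K : {set {set 'I_n}}).

Definition face (j : nat) := {s : {set 'I_n} | (s \in K) && (#|s| == j.+1)}.

Definition cochain (j : nat) := {ffun face j -> 'F_2}.

HB.instance Definition _ j := GRing.Zmodule.on (cochain j).
HB.instance Definition _ j := Finite.on (cochain j).
HB.instance Definition _ j := [finGroupMixin of cochain j for +%R].

Definition coboundary (j : nat) (f : cochain j) : cochain j.+1 :=
  [ffun s : face j.+1 => \sum_(t : face j | val t \subset val s) f t].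

Lemma coboundaryD (j : nat) :
  {in [set: cochain j] &, {morph @coboundary j : f g / (f * g)%g}}.
Proof.
move=> f g _ _; apply/ffunP=> s; rewrite !ffunE -big_split /=.
by apply: eq_bigr => t _; rewrite ffunE.
Qed.

Canonical coboundary_morphism (j : nat) := Morphism (@coboundaryD j).

(* The group law of cochain j is addition, so this is the additive quotient
   ker d_1 / im d_0, and it is zero iff it equals the trivial group 1%g. *)
Definition H1 : {set coset_of (@coboundary 0 @* [set: cochain 0])} :=
  ('ker (@coboundary 1) / @coboundary 0 @* [set: cochain 0])%g.

Definition isolated_edge (e : {set 'I_n}) : bool :=
  [&& e \in K, #|e| == 2 & [forall t in K, (#|t| == 3) ==> ~~ (e \subset t)]].

End Cohomology.

Section Process.
Variable n : nat.

Definition triangle := {t : {set 'I_n} | #|t| == 3}.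

Definition complex_of (T : {set triangle}) : {set {set 'I_n}} :=
  [set s : {set 'I_n} | 0 < #|s| <= 2]%N :|: [set val t | t in T].

(* An outcome of the process is the sequence of triangles in the order in
   which they are added; outcomes with a repetition get probability 0. *)
Definition outcome := ('C(n, 3)).-tuple triangle.

(* The triangles added during the first M steps. *)
Definition added (w : outcome) (M : nat) : {set triangle} :=
  [set t in take M w].

Definition Y (w : outcome) (M : nat) : {set {set 'I_n}} :=
  complex_of (added w M).

(* Least M <= 'C(n, 3) such that Y w M satisfies P, and 'C(n, 3).+1 if there
   is none. *)
Definition hitting_time (P : pred {set {set 'I_n}}) (w : outcome) : nat :=
  find (fun M => P (Y w M)) (iota 0 ('C(n, 3)).+1).

Definition M1 : outcome -> nat :=
  hitting_time (fun K => [forall e, ~~ isolated_edge K e]).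

Definition M3 : outcome -> nat := hitting_time (fun K => H1 K == 1%g).

Section Law.
Variable R : numFieldType.

(* Conditional probability that t is the triangle added at step M.+1, given
   that T is the set of the M triangles added before. *)
Definition step_prob (M : nat) (T : {set triangle}) (t : triangle) : R :=
  if t \in T then 0 else (('C(n, 3) - M)%N%:R)^-1.

Definition outcome_prob (w : outcome) : R :=
  \prod_(i < 'C(n, 3)) step_prob i (added w i) (tnth w i).

Definition prob (E : pred outcome) : R := \sum_(w | E w) outcome_prob w.

End Law.

End Process.

(* Main.v *)
(* At the time [M] when the density of missing triangles, [x = 1 - M / 'C(n, 3)],
   first satisfies [x ^ n <= n ^ (- 15 / 8)], the second moment method shows
   that isolated edges are still present with high probability. If [M1 <> M3]
   and there is an isolated edge at time [M], then at time [M1 >= M] there is a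
   nontrivial cocycle; take one, [G], with the least number [k >= 2] of edges.
   It is connected, and its odd triangles (those with an odd number of edges in
   [G]), at least [k n / 3] in number by the argument of Meshulam and Wallach,
   are all missing at time [M].

   It remains to sum [x ^ b(G)] over such [G], where [b(G)] is the number of odd
   triangles. If [l] edges of [G] have both ends of degree less than [D = n / 50],
   then also [b(G) >= l (n - 2 D)], since a triangle meeting [G] in a single edge
   is odd. The other [k - l] edges are covered by at most [2 k / D] vertices, so
   there are only [exp(O(k))] choices for them, and ['C('C(n, 2), l)] choices for
   the [l] edges. For [k ^ 2 > n] this suffices, using the first bound on [b(G)]
   when [l <= 3 k / 10] and the second one otherwise. For [k ^ 2 <= n] all edges
   have ends of small degree and connectedness bounds the number of graphs. *)
Require Import Defs.
From mathcomp Require Import all_boot all_order all_algebra all_fingroup.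
From mathcomp Require Import zify ring lra.

Set Implicit Arguments.
Unset Strict Implicit.
Unset Printing Implicit Defensive.

(** * Graphs and odd triangles *)

Section Graphs.
Variable n : nat.
Notation V := 'I_n.
Implicit Types (G F : {set {set V}}) (e t : {set V}) (S : {set V}).
Implicit Types (A B : {set triangle n}).

(** A 1-cochain over Z/2 is encoded by its support, a set of edges: [symdiff] is then addition,
    [odd_face] evaluates the coboundary at a triangle, and [cut S] is the coboundary of the
    indicator function of [S]. *)
Definition edges : {set {set V}} := [set e : {set V} | #|e| == 2].
Definition cut S : {set {set V}} := [set e : {set V} in edges | odd #|S :&: e|].
Definition symdiff G F : {set {set V}} := [set e | (e \in G) (+) (e \in F)].
Definition odd_face G t := odd #|[set e : {set V} in G | e \subset t]|.
Definition odd_triangles G : {set triangle n} := [set t : triangle n | odd_face G (val t)].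
Definition nbr G u : {set V} := [set v | [set u; v] \in G].

(** [A] is the set of triangles present: a cocycle is even on each of them, and the coboundaries are
    the cuts. *)
Definition nontrivial_cocycle A G :=
  [&& G \subset edges, [disjoint A & odd_triangles G]
    & [forall S, G != cut S]].

Lemma edgesP e : reflect (exists u v, u != v /\ e = [set u; v]) (e \in edges).
Proof. by rewrite inE; apply: cards2P. Qed.

Lemma edge_set2 u v : ([set u; v] \in edges) = (u != v).
Proof. by rewrite inE cards2; case: (u != v). Qed.

Lemma card_edges : #|edges| = 'C(n, 2).
Proof. by rewrite card_draws card_ord. Qed.

Lemma triangleP t : #|t| = 3 ->
  exists a b c, [/\ a != b, b != c, a != c & t = [set a; b; c]].
Proof.
move=> t3; have /card_gt0P[a at_] : 0 < #|t| by rewrite t3.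
have /cards2P[b [c [bc tE]]] : #|t :\ a| == 2 by move: t3; rewrite (cardsD1 a) at_; lia.
have ba : b \in t :\ a by rewrite tE set21.
have ca : c \in t :\ a by rewrite tE set22.
move: ba ca; rewrite !inE => /andP[ba _] /andP[ca _].
exists a, b, c; split; rewrite // 1?eq_sym //.
by rewrite -(setD1K at_) tE setUA.
Qed.

Lemma triangle_val t : #|t| = 3 -> exists s : triangle n, val s = t.
Proof. by move=> /eqP t3; exists (exist _ t t3). Qed.

Lemma edges_in_set3 (a b c : V) : a != b -> b != c -> a != c ->
  [set e : {set V} in edges | e \subset [set a; b; c]] =
  [set [set a; b]; [set b; c]; [set a; c]].
Proof.
move=> ab bc ac; apply/setP=> e; rewrite !inE; apply/idP/idP; last first.
  case/orP=> [/orP[]|] /eqP->; rewrite cards2 ?ab ?bc ?ac /=;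
    by rewrite subUset !sub1set !inE !eqxx ?orbT.
case/andP=> /cards2P[x [y [xy ->]]]; rewrite subUset !sub1set !inE.
case/andP=> /orP[/orP[]|] /eqP xE /orP[/orP[]|] /eqP yE;
  move: xy; rewrite xE yE ?eqxx // => _;
  by rewrite ?(setUC [set b] [set a]) ?(setUC [set c] [set b]) ?(setUC [set c] [set a])
             ?eqxx ?orbT.
Qed.

Lemma set2_neq (a b c : V) : a != b -> b != c -> a != c ->
  [/\ [set a; b] != [set b; c], [set a; b] != [set a; c]
    & [set b; c] != [set a; c]].
Proof.
move=> ab bc ac; split; apply/eqP=> /setP; [move/(_ a)|move/(_ b)|move/(_ a)];
  rewrite !inE !eqxx ?(negPf ab) ?(negPf ac) ?(negPf bc) //=.
by rewrite eq_sym (negPf ab).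
Qed.

Lemma odd_face3 G (a b c : V) : G \subset edges ->
  a != b -> b != c -> a != c ->
  odd_face G [set a; b; c] =
  ([set a; b] \in G) (+) ([set b; c] \in G) (+) ([set a; c] \in G).
Proof.
move=> sG ab bc ac; have [n1 n2 n3] := set2_neq ab bc ac.
have -> : odd_face G [set a; b; c] =
    odd (\sum_(e in [set [set a; b]; [set b; c]; [set a; c]]) (e \in G)).
  rewrite /odd_face -edges_in_set3 // -sum1_card big_mkcond [in RHS]big_mkcond.
  congr odd; apply: eq_bigr => e _; rewrite inE in_set.
  by have [/(subsetP sG)->|_] /= := boolP (e \in G); case: ifP.
rewrite (setUC [set [set a; b]; [set b; c]]) big_setU1 /=; last first.
  by rewrite !inE negb_or ![[set a; c] == _]eq_sym n2 n3.
rewrite big_setU1 ?inE //= big_set1 !oddD !oddb.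
by case: (_ \in _); case: (_ \in _); case: (_ \in _).
Qed.

Lemma cut_set2 S (u v : V) : u != v ->
  ([set u; v] \in cut S) = (u \in S) (+) (v \in S).
Proof.
move=> uv; rewrite inE edge_set2 uv /=.
have -> : #|S :&: [set u; v]| = (u \in S) + (v \in S).
  rewrite setIC -sum1_card big_mkcond /= (bigD1 u) //= (bigD1 v) 1?eq_sym //=.
  rewrite big1 ?addn0 => [|w /andP[wu wv]]; last by rewrite !inE (negPf wu) (negPf wv).
  by rewrite !inE !eqxx orbT /=; case: (u \in S); case: (v \in S).
by rewrite oddD !oddb.
Qed.

Lemma cut_sub S : cut S \subset edges.
Proof. by apply/subsetP=> e; rewrite inE => /andP[]. Qed.

Lemma symdiff_sub G F : G \subset edges -> F \subset edges ->
  symdiff G F \subset edges.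
Proof.
move=> /subsetP sG /subsetP sF; apply/subsetP=> e; rewrite inE.
by case eG: (e \in G) => /=; [rewrite sG|apply: sF].
Qed.

Lemma odd_face_symdiff G F t : #|t| = 3 -> G \subset edges -> F \subset edges ->
  odd_face (symdiff G F) t = odd_face G t (+) odd_face F t.
Proof.
move=> /triangleP[a [b [c [ab bc ac ->]]]] sG sF.
rewrite !odd_face3 ?symdiff_sub // !inE.
by do ![case: (_ \in _)].
Qed.

(** This is d d = 0: a walk once around a triangle enters and leaves [S] equally often. *)
Lemma odd_face_cut S t : #|t| = 3 -> odd_face (cut S) t = false.
Proof.
move=> /triangleP[a [b [c [ab bc ac ->]]]].
rewrite odd_face3 ?cut_sub // !cut_set2 //.
by do ![case: (_ \in _)].
Qed.

Lemma symdiff_cut S S' : symdiff (cut S) (cut S') = cut [set v | (v \in S) (+) (v \in S')].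
Proof.
apply/setP=> e; rewrite inE; have [/edgesP[u [v [uv ->]]]|eN] := boolP (e \in edges).
  by rewrite !cut_set2 // !inE; do ![case: (_ \in _)].
by rewrite !inE; rewrite inE in eN; rewrite (negPf eN).
Qed.

Lemma symdiffK G F : symdiff (symdiff G F) F = G.
Proof. by apply/setP=> e; rewrite !inE addbK. Qed.

(** Adding a coboundary changes neither the odd triangles nor the cohomology class. *)
Lemma nontrivial_symdiff A G S :
  nontrivial_cocycle A G -> nontrivial_cocycle A (symdiff G (cut S)).
Proof.
case/and3P=> sG dG /forallP nG; apply/and3P; split.
- by rewrite symdiff_sub ?cut_sub.
- suff -> : odd_triangles (symdiff G (cut S)) = odd_triangles G by [].
  apply/setP=> t; have /eqP t3 := valP t; rewrite !inE.
  by rewrite odd_face_symdiff ?cut_sub // odd_face_cut // addbF.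
- apply/forallP=> S'; apply: contra (nG [set v | (v \in S') (+) (v \in S)]).
  by move=> /eqP E; rewrite -symdiff_cut -E symdiffK.
Qed.

(** * Triangles that meet a graph in a single edge *)

Definition solo_triangles G e : {set triangle n} :=
  [set t : triangle n | [set f : {set V} in G | f \subset val t] == [set e]].

Lemma nbr_irrefl G u : G \subset edges -> u \notin nbr G u.
Proof.
move=> /subsetP sG; rewrite inE; apply/negP=> /sG.
by rewrite edge_set2 eqxx.
Qed.

(** Every vertex adjacent to neither end completes the edge to such a triangle. *)
Lemma card_solo G (u v : V) : G \subset edges -> [set u; v] \in G ->
  n - (#|nbr G u| + #|nbr G v|) <= #|solo_triangles G [set u; v]|.
Proof.
move=> sG uvG; have uv : u != v by rewrite -edge_set2 (subsetP sG).
pose W := ~: (nbr G u :|: nbr G v).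
have leW : n - (#|nbr G u| + #|nbr G v|) <= #|W|.
  have := cardsC (nbr G u :|: nbr G v); rewrite card_ord -/W.
  have := cardsUI (nbr G u) (nbr G v); lia.
apply: leq_trans leW _.
(* The ends themselves are not in [W], as each is a neighbour of the other. *)
have Wok w : w \in W -> [/\ w != u, w != v, [set u; w] \notin G & [set v; w] \notin G].
  rewrite !inE negb_or => /andP[uw vw]; split=> //.
    by apply: contra vw => /eqP->; rewrite setUC.
  by apply: contra uw => /eqP->.
have imW : [set w |: [set u; v] | w in W] \subset
           [set val t | t in solo_triangles G [set u; v]].
  apply/subsetP=> _ /imsetP[w /Wok[wu wv uw vw] ->].
  have [|t tE] := @triangle_val (w |: [set u; v]).
    by rewrite cardsU1 cards2 uv !inE negb_or wu wv.
  apply/imsetP; exists t; last by [].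
  rewrite inE tE; apply/eqP/setP=> f.
  have -> : w |: [set u; v] = [set u; v; w] by rewrite setUC.
  rewrite [RHS]inE inE; have [fE|fE] := boolP (f \in edges); last first.
    rewrite (negPf (contra (subsetP sG f) fE)) /=; apply/esym.
    by apply: contraNF fE => /eqP->; apply: (subsetP sG).
  have := edges_in_set3 uv; move/(_ w); rewrite ![_ == w]eq_sym => /(_ wv wu) /setP /(_ f).
  rewrite in_set fE /= => ->; rewrite !inE.
  apply/andP/eqP=> [[fG /orP[/orP[]|] /eqP fS]|->] //; last by rewrite uvG eqxx.
    by rewrite -fS fG in vw.
  by rewrite -fS fG in uw.
have := subset_leq_card imW; rewrite card_in_imset => [|w w' /Wok[wu wv _ _] _ E].
  by rewrite card_imset //; apply: val_inj.
have : w \in w' |: [set u; v] by rewrite -E !inE eqxx.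
by rewrite !inE (negPf wu) (negPf wv) /= orbF => /eqP.
Qed.

(** * Degrees, and counting graphs by their low edges *)

Definition low D G : {set {set V}} := [set e : {set V} in G | [forall v in e, #|nbr G v| < D]].
Definition high D G : {set V} := [set v | D <= #|nbr G v|].

(** Solo triangles are odd, and no triangle is solo for two edges, so the bounds for the low edges
    add up. *)
Lemma card_odd_triangles_low D G : G \subset edges ->
  #|low D G| * (n - 2 * D) <= #|odd_triangles G|.
Proof.
move=> sG; rewrite -sum_nat_const.
have step e : e \in low D G -> n - 2 * D <= #|solo_triangles G e|.
  rewrite inE => /andP[eG /forall_inP lo].
  have /edgesP[u [v [uv eE]]] := subsetP sG _ eG.
  rewrite eE in eG lo *; apply: leq_trans (card_solo sG eG).
  have := lo u; have := lo v; rewrite !inE !eqxx orbT => /(_ isT) ? /(_ isT) ?; lia.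
apply: (@leq_trans (\sum_(e in low D G) #|solo_triangles G e|)); first exact: leq_sum.
have cE e : #|solo_triangles G e| =
    \sum_(t : triangle n) ([set f : {set V} in G | f \subset val t] == [set e]).
  by rewrite -sum1dep_card big_mkcond; apply: eq_bigr => t _; case: ifP.
under eq_bigr => e _ do rewrite cE.
rewrite exchange_big /= -[X in _ <= X]sum1_card [X in _ <= X]big_mkcond /=.
apply: leq_sum => t _; rewrite inE /odd_face.
rewrite (eq_bigr (fun e => if [set f : {set V} in G | f \subset val t] == [set e]
                          then 1 else 0)) => [|e _]; last by case: ifP.
rewrite -big_mkcondr sum1dep_card; set W := [set _ | _].
have [->|[e eW]] := set_0Vmem W; first by rewrite cards0.
move: (eW); rewrite inE => /andP[_ /eqP->]; rewrite cards1 /=.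
apply/card_le1_eqP=> e1 e2; rewrite !inE => /andP[_ /eqP->] /andP[_ /eqP].
by move/set1_inj.
Qed.

Lemma card_nbr G v : G \subset edges -> #|nbr G v| = #|[set e : {set V} in G | v \in e]|.
Proof.
move=> sG; have <- : [set [set v; w] | w in nbr G v] = [set e : {set V} in G | v \in e].
  apply/setP=> e; apply/imsetP/idP=> [[w wN ->]|]; first by rewrite !inE eqxx andbT in wN *.
  rewrite inE => /andP[eG]; have /edgesP[x [y [xy eE]]] := subsetP sG _ eG.
  by rewrite eE !inE => /orP[]/eqP->; [exists y|exists x]; rewrite ?inE -?eE // setUC -?eE.
rewrite card_in_imset // => w w' wN w'N /setP/(_ w); rewrite !inE eqxx orbT.
by case/esym/orP=> /eqP // wv; move: wN (nbr_irrefl v sG); rewrite wv => ->.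
Qed.

(** The degrees sum to twice the number of edges. *)
Lemma card_high D G : G \subset edges -> D * #|high D G| <= 2 * #|G|.
Proof.
move=> sG; rewrite mulnC -sum_nat_const.
apply: (@leq_trans (\sum_(v in high D G) #|nbr G v|)).
  by apply: leq_sum => v; rewrite inE.
apply: (@leq_trans (\sum_v #|nbr G v|)).
  by rewrite [X in _ <= X](bigID (mem (high D G))) /= leq_addr.
under eq_bigr => v _ do rewrite card_nbr // -sum1dep_card big_mkcondr.
rewrite exchange_big /= mulnC -sum_nat_const; apply: leq_sum => e eG.
by rewrite -big_mkcond sum1_card; have := subsetP sG _ eG; rewrite inE => /eqP->.
Qed.

Lemma low_not_high D G e : e \in G :\: low D G -> exists2 v, v \in e & v \in high D G.
Proof.
rewrite !inE => /andP[eN eG]; rewrite eG /= in eN.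
by case/forall_inPn: eN => v ve vD; exists v; rewrite // inE leqNgt.
Qed.

(* Contains every graph with a vertex cover of size at most [h]. *)
Definition stars h : {set {set {set V}}} :=
  [set \bigcup_(i < h) [set [set (p i).1; u] | u in (p i).2] |
     p : {ffun 'I_h -> V * {set V}}].

Lemma card_stars h : #|stars h| <= (n * 2 ^ n) ^ h.
Proof.
apply: leq_trans (leq_imset_card _ _) _.
have -> : n * 2 ^ n = #|{: V * {set V}}|.
  by rewrite card_prod -(cardsT {set V}) -powersetT card_powerset cardsT !card_ord.
by rewrite card_ffun card_ord.
Qed.

Lemma mem_stars G (H : {set V}) h : 0 < n -> G \subset edges ->
  (forall e, e \in G -> exists2 v, v \in e & v \in H) -> #|H| <= h ->
  G \in stars h.
Proof.
move=> n0 sG GH leH; pose v0 : V := Ordinal n0.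
(* Indices past [#|H|] get the default vertex [v0] with its own neighbourhood, which contributes
   only edges of [G]. *)
pose p : {ffun 'I_h -> V * {set V}} :=
  [ffun i : 'I_h => let v := nth v0 (enum H) i in (v, nbr G v)].
apply/imsetP; exists p => //; apply/setP=> e; apply/idP/bigcupP=> [eG|[i _]].
  have [v ve vH] := GH e eG.
  have iv : index v (enum H) < h by rewrite (leq_trans _ leH) // cardE index_mem mem_enum.
  exists (Ordinal iv) => //; rewrite ffunE /= nth_index ?mem_enum //.
  have /edgesP[x [y [xy eE]]] := subsetP sG _ eG.
  apply/imsetP; move: ve; rewrite eE !inE => /orP[]/eqP->;
    [exists y|exists x]; by rewrite ?inE -?eE // setUC -?eE.
by case/imsetP=> u; rewrite ffunE /= inE => uG ->.
Qed.

(** [G] is recovered from its other edges, which are covered by the high vertices and so form a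
    member of [stars h], and from its low edges, an [l]-subset of all edges. *)
Lemma card_low_high D h l : 0 < n ->
  #|[set G : {set {set V}} | [&& G \subset edges, #|low D G| == l & #|high D G| <= h]]|
    <= (n * 2 ^ n) ^ h * 'C('C(n, 2), l).
Proof.
move=> n0; set X := [set _ | _].
have injf : injective (fun G => (G :\: low D G, low D G)).
  move=> G G' [E1 E2]; rewrite -(setID G (low D G)) -[RHS](setID G' (low D G')) E1.
  by congr (_ :|: _); rewrite -!(setIC (low D _)) !(setIidPl _) //;
    apply/subsetP=> e; rewrite inE => /andP[].
rewrite -(card_imset _ injf) -card_edges -cards_draws.
apply: leq_trans (leq_mul (card_stars h) (leqnn _)); rewrite -cardsX.
apply: subset_leq_card; apply/subsetP=> _ /imsetP[G + ->].
rewrite inE => /and3P[sG lG hG]; rewrite !inE /= lG andbT.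
apply/andP; split; last first.
  by apply: subset_trans sG; apply/subsetP=> e; rewrite inE => /andP[].
apply: (@mem_stars _ (high D G)) => //; last exact: low_not_high.
by apply: subset_trans sG; apply: subsetDl.
Qed.


(** * Connected edge sets, their enumeration, and minimal cocycles *)

Definition connected_graph G :=
  [forall F : {set {set V}}, [&& F \subset G, F != set0 & F != G] ==>
     [exists e in F, [exists f in G :\: F, ~~ [disjoint e & f]]]].

Definition grow F : {set {set V}} :=
  [set e in edges | [exists f in F, ~~ [disjoint e & f]]].

(** Sets grown from one edge by adding, [k] times, an edge that meets the current set. An added edge
    may already be present, so the size is only bounded by [k.+1]. *)
Fixpoint reach k : {set {set {set V}}} :=
  if k is k'.+1 then \bigcup_(F in reach k') [set e |: F | e in grow F]
  else [set [set e] | e in edges].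

Lemma reach_sub k F : F \in reach k -> F \subset edges /\ #|F| <= k.+1.
Proof.
elim: k F => [|k IHk] F /=.
  by case/imsetP=> e eE ->; rewrite sub1set cards1.
case/bigcupP=> F' /IHk[sF' cF'] /imsetP[e + ->]; rewrite inE => /andP[eE _].
by rewrite subUset sub1set eE sF' cardsU1; split=> //; case: (e \notin F'); lia.
Qed.

Lemma card_grow F : F \subset edges -> #|grow F| <= 2 * #|F| * n.
Proof.
move=> sF; have cE : #|cover F| <= 2 * #|F|.
  apply: leq_trans (leq_card_cover F) _; rewrite mulnC -sum_nat_const.
  by apply: leq_sum => e /(subsetP sF); rewrite inE => /eqP->.
apply: leq_trans (leq_mul cE (leqnn n)); rewrite -[X in _ * X]card_ord -cardsT -cardsX.
apply: leq_trans (leq_imset_card (fun p : V * V => [set p.1; p.2]) _).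
apply: subset_leq_card; apply/subsetP=> e; rewrite inE => /andP[/edgesP[u [v [uv ->]]]].
case/exists_inP=> f fF /pred0Pn[w /= /andP[]]; rewrite !inE => wE wf.
have wC : w \in cover F by apply/bigcupP; exists f.
by apply/imsetP; case/orP: wE => /eqP wE; rewrite wE in wC;
  [exists (u, v)|exists (v, u)]; rewrite ?inE ?wC //= setUC.
Qed.

(** There are at most [n ^ 2] first edges; each later one has an end among the at most [2 * k]
    vertices covered so far, and [n] candidates for the other end. *)
Lemma card_reach k : #|reach k| <= n ^ 2 * (2 * k * n) ^ k.
Proof.
elim: k => [|k IHk] /=.
  apply: leq_trans (leq_imset_card _ _) _; rewrite card_edges muln1.
  by rewrite bin2 -divn2 (leq_trans (leq_div _ _)) // -mulnn leq_mul2l leq_pred orbT.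
apply: (@leq_trans (\sum_(F in reach k) 2 * k.+1 * n)).
  elim/big_rec2: _ => [|F y X /reach_sub[sF cF] IH]; first by rewrite cards0.
  apply: leq_trans (leq_card_setU _ _) _; rewrite leq_add //.
  apply: leq_trans (leq_imset_card _ _) (leq_trans (card_grow sF) _).
  by rewrite leq_mul2r leq_mul2l cF !orbT.
rewrite sum_nat_const (expnSr (2 * k.+1 * n)) [X in _ <= X]mulnA.
rewrite leq_mul2r (leq_trans IHk) ?orbT //.
rewrite leq_mul2l; apply/orP; right.
by case: (k) => // k'; rewrite leq_exp2r // !leq_mul.
Qed.

(** Connectedness, phrased on edges, extends a nonempty proper part of [G] by an edge of [G] meeting
    it; at [k.+1] edges the part is all of [G]. *)
Lemma mem_reach G k : connected_graph G -> G \subset edges -> #|G| = k.+1 ->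
  G \in reach k.
Proof.
move=> cG sG Gk.
suff H j : j <= k -> exists2 F, F \in reach j & (F \subset G) && (#|F| == j.+1).
  have [F FR /andP[FG /eqP Fk]] := H k (leqnn k).
  by rewrite -(_ : F = G) //; apply/eqP; rewrite eqEcard FG Fk Gk /=.
elim: j => [_|j IHj jk].
  have /card_gt0P[e eG] : 0 < #|G| by rewrite Gk.
  exists [set e]; rewrite ?sub1set ?eG ?cards1 //=.
  by apply/imsetP; exists e; rewrite ?(subsetP sG).
have [F FR /andP[FG /eqP Fj]] := IHj (ltnW jk).
have F0 : F != set0 by rewrite -card_gt0 Fj.
have FnG : F != G by apply/eqP=> E; move: Fj; rewrite E Gk; lia.
have /forallP/(_ F) := cG; rewrite FG F0 FnG /= => /exists_inP[f fF /exists_inP[e]].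
rewrite inE => /andP[eF eG] fe; exists (e |: F).
  apply/bigcupP; exists F => //; apply/imsetP; exists e => //.
  rewrite inE (subsetP sG) //=; apply/exists_inP; exists f => //.
  by rewrite disjoint_sym.
by rewrite subUset sub1set eG FG cardsU1 eF Fj /=.
Qed.

Lemma edges_meet e f t : #|t| = 3 -> e \in edges -> f \in edges ->
  e \subset t -> f \subset t -> ~~ [disjoint e & f].
Proof.
rewrite !inE => t3 /eqP e2 /eqP f2 et ft; rewrite -setI_eq0 -card_gt0.
have : e :|: f \subset t by rewrite subUset et.
by move/subset_leq_card; have := cardsUI e f; lia.
Qed.

(* If no edge of [F] met an edge of [G :\: F], both would be smaller cocycles. *)
Lemma min_cocycle_connected A G : nontrivial_cocycle A G ->
  (forall F, nontrivial_cocycle A F -> #|G| <= #|F|) -> connected_graph G.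
Proof.
move=> /and3P[sG dG /forallP nG] minG.
apply/forallP=> F; apply/implyP=> /and3P[sFG F0 FG].
apply: contraT => /exists_inPn noadj.
have sF : F \subset edges by apply: subset_trans sG.
have sF' : G :\: F \subset edges by apply: subset_trans sG; apply: subsetDl.
have GE : symdiff F (G :\: F) = G.
  apply/setP=> e; rewrite !inE; have := subsetP sFG e.
  by case: (e \in F) => [->|] //=; case: (e \in G).
(* On a triangle of [A] the two parts have equal parity, since [G] is even there. Were both odd,
   each would have an edge in the triangle, and these two edges would meet. *)
have even_part H : H = F \/ H = G :\: F -> [disjoint A & odd_triangles H].
  move=> HE; apply/pred0P=> t /=; apply/negP=> /andP[tA]; rewrite inE => oddH.
  have /eqP t3 := valP t.
  have evenG : odd_face G (val t) = false.
    by apply/negP=> oddG; move/pred0P: dG => /(_ t) /=; rewrite tA inE oddG.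
  move: evenG; rewrite -GE odd_face_symdiff //.
  have ex (H' : {set {set V}}) : odd_face H' (val t) ->
      exists2 e : {set V}, e \in H' & e \subset val t.
    by move/odd_gt0/card_gt0P=> [e]; rewrite inE => /andP[]; exists e.
  have := ex F; have := ex (G :\: F).
  case oF: (odd_face F _); case oF': (odd_face (G :\: F) _) => //.
    move=> /(_ isT) [e eF' et] /(_ isT) [f fF ft] _.
    case/negP: (noadj f fF); apply/exists_inP; exists e => //.
    exact: edges_meet t3 (subsetP sF _ fF) (subsetP sF' _ eF') ft et.
  by case: HE oddH => ->; rewrite ?oF ?oF'.
(* Both parts have fewer edges than [G], so by minimality they are cuts; their sum [G] would then be
   a cut. *)
have triv H : H = F \/ H = G :\: F -> exists S, H = cut S.
  move=> HE; have : ~~ nontrivial_cocycle A H.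
    apply/negP=> /minG; rewrite leqNgt => /negP; apply.
    have := cardsID F G; rewrite (setIidPr sFG).
    move: F0; rewrite -card_gt0.
    have : F \proper G by rewrite properEneq FG sFG.
    by move/proper_card; case: HE => ->; lia.
  rewrite /nontrivial_cocycle even_part // andTb negb_and.
  have -> /= : H \subset edges by case: HE => ->.
  by move/forallPn=> [S]; rewrite negbK => /eqP ->; exists S.
have [S FE] := triv F (or_introl erefl); have [S' FE'] := triv _ (or_intror erefl).
have := nG [set v | (v \in S) (+) (v \in S')].
by rewrite -symdiff_cut -FE -FE' GE eqxx.
Qed.

(* Meshulam and Wallach: the edges of [G + cut (nbr G v)] avoid [v], and [e] is
   one of them iff [v |: e] is odd. *)
Lemma card_odd_triangles_at A G v : nontrivial_cocycle A G ->
  (forall F, nontrivial_cocycle A F -> #|G| <= #|F|) ->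
  #|G| <= #|[set t in odd_triangles G | v \in val t]|.
Proof.
move=> nG minG; have /and3P[sG _ _] := nG.
(* By minimality this sum has at least [#|G|] edges, which [e] to [v |: e] sends injectively to odd
   triangles at [v]. *)
have nG' := nontrivial_symdiff (nbr G v) nG.
apply: leq_trans (minG _ nG') _.
have /and3P[sG' _ _] := nG'; set G' := symdiff _ _ in sG' *.
have vG' e : e \in G' -> v \notin e.
  move=> eG'; apply/negP=> ve; move: (eG').
  have [u vu eE] : exists2 u, v != u & e = [set v; u].
    have /edgesP[x [y [xy eE]]] := subsetP sG' _ eG'.
    move: ve; rewrite eE !inE => /orP[]/eqP->; [exists y|exists x] => //.
      by rewrite eq_sym.
    by rewrite setUC.
  by rewrite eE inE cut_set2 // (negPf (nbr_irrefl v sG)) /= inE addbb.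
have injv : {in G' &, injective (fun e => v |: e)}.
  by move=> e f /vG' ve /vG' vf /= E; rewrite -(setU1K ve) E setU1K.
rewrite -(card_in_imset injv) -[X in _ <= X](card_imset _ val_inj).
apply: subset_leq_card; apply/subsetP=> _ /imsetP[e eG' ->].
have ve := vG' e eG'; have /edgesP[u [w [uw eE]]] := subsetP sG' _ eG'.
have [|t tE] := @triangle_val (v |: e).
  by rewrite cardsU1 ve eE cards2 uw.
apply/imsetP; exists t => //; rewrite !inE tE setU11 andbT.
move: eG'; rewrite eE inE cut_set2 // => eG'.
move: ve; rewrite eE !inE negb_or => /andP[vu vw].
rewrite setUA odd_face3 //.
by move: eG'; rewrite !inE; do ![case: (_ \in _)].
Qed.

(** Summing the bound at [v] over all [v] counts each triangle at its three vertices. *)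
Lemma card_odd_triangles A G : nontrivial_cocycle A G ->
  (forall F, nontrivial_cocycle A F -> #|G| <= #|F|) ->
  n * #|G| <= 3 * #|odd_triangles G|.
Proof.
move=> nG minG; apply: (@leq_trans (\sum_(v : V) #|[set t in odd_triangles G | v \in val t]|)).
  rewrite -[X in X * _ <= _]card_ord -sum_nat_const; apply: leq_sum => v _.
  exact: card_odd_triangles_at nG minG.
under eq_bigr => v _ do rewrite -sum1dep_card big_mkcondr.
rewrite exchange_big /= mulnC -sum_nat_const; apply: leq_sum => t _.
by rewrite -big_mkcond sum1_card (eqP (valP t)).
Qed.

End Graphs.

(** * The first cohomology group *)

Section FirstCohomology.
Import GRing.Theory.
Local Open Scope ring_scope.

Lemma F2E (x : 'F_2) : x = (x != 0)%:R.
Proof. by case: x => [[|[|m]] ltm] //; apply: val_inj. Qed.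

Lemma natF2E k : k%:R = (odd k)%:R :> 'F_2.
Proof.
rewrite -[k in LHS]odd_double_half natrD -muln2 natrM.
by rewrite (_ : 2%:R = 0 :> 'F_2) ?mulr0 ?addr0 //; apply: val_inj.
Qed.

Lemma F2_nat_inj (b c : bool) : b%:R = c%:R :> 'F_2 -> b = c.
Proof. by case: b; case: c => // /(congr1 val). Qed.

Variables (n : nat) (A : {set triangle n}).
Notation V := 'I_n.
Notation K := (complex_of A).

Lemma complex_ofE (s : {set V}) :
  (s \in K) = (0 < #|s| <= 2)%N || (s \in [set val t | t in A]).
Proof. by rewrite inE inE. Qed.

Lemma card_val_triangle (t : triangle n) : #|val t| = 3%N.
Proof. exact: eqP (valP t). Qed.

Lemma face_val j (s : {set V}) : s \in K -> #|s| = j.+1 ->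
  exists t : face K j, val t = s.
Proof. by move=> sK /eqP cs; have h := introT andP (conj sK cs); exists (exist _ s h). Qed.

Lemma card_face j (s : face K j) : #|val s| = j.+1.
Proof. by have /andP[_ /eqP] := valP s. Qed.

Lemma face2P (s : face K 2) : exists2 t, t \in A & val s = val t.
Proof.
have /andP[+ /eqP cs] := valP s; rewrite complex_ofE cs /=.
by case/imsetP=> t tA ->; exists t.
Qed.

(** All edges belong to [K], so this is a bijection from the subsets of [edges n] to the
    1-cochains. *)
Definition chi (G : {set {set V}}) : cochain K 1 :=
  [ffun s : face K 1 => (val s \in G)%:R].

Lemma chi_inj (G F : {set {set V}}) : G \subset edges n -> F \subset edges n ->
  chi G = chi F -> G = F.
Proof.
move=> sG sF /ffunP E; apply/setP=> e; have [eE|eN] := boolP (e \in edges n).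
  rewrite inE in eE; have eK : e \in K by rewrite complex_ofE (eqP eE).
  have [s <-] := @face_val 1 e eK (eqP eE).
  by have := E s; rewrite !ffunE => /F2_nat_inj.
by rewrite (negPf (contra (subsetP sG e) eN)) (negPf (contra (subsetP sF e) eN)).
Qed.

Lemma chi_surj (f : cochain K 1) : exists2 G : {set {set V}}, G \subset edges n & f = chi G.
Proof.
exists [set val s | s in [pred s : face K 1 | f s != 0]].
  by apply/subsetP=> _ /imsetP[s _ ->]; rewrite inE card_face.
by apply/ffunP=> s; rewrite ffunE mem_imset ?inE -?F2E //; apply: val_inj.
Qed.

Lemma coboundary_chi (G : {set {set V}}) (s : face K 2) : G \subset edges n ->
  coboundary (chi G) s = (odd_face G (val s))%:R.
Proof.
move=> sG; rewrite ffunE (eq_bigr (fun t : face K 1 => (val t \in G)%:R)); last first.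
  by move=> t _; rewrite ffunE.
rewrite -natr_sum natF2E; congr (odd _)%:R.
rewrite -big_mkcondr sum1dep_card -(card_imset _ val_inj).
congr #|pred_of_set _|; apply/setP=> e; rewrite inE; apply/imsetP/andP=> [[t + ->]|[eG es]].
  by rewrite inE => /andP[-> ->].
have := subsetP sG e eG; rewrite inE => /eqP ce.
have eK : e \in K by rewrite complex_ofE ce.
by have [t tE] := @face_val 1 e eK ce; exists t; rewrite ?inE tE ?eG ?es.
Qed.

Lemma vertex_in_complex (v : V) : [set v] \in K.
Proof. by rewrite complex_ofE cards1. Qed.

Lemma coboundary_edge (g : cochain K 0) (u v : face K 0) (s : face K 1) :
  u != v -> val s = val u :|: val v -> coboundary g s = g u + g v.
Proof.
move=> uv sE; rewrite ffunE (bigD1 u) /=; last by rewrite sE subsetUl.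
rewrite (bigD1 v) /=; last by rewrite sE subsetUr eq_sym.
rewrite big1 ?addr0 // => t /andP[/andP[]]; rewrite sE.
have /eqP/cards1P[x tE] := card_face t; have /eqP/cards1P[y uE] := card_face u.
have /eqP/cards1P[z vE] := card_face v.
rewrite -!val_eqE /= tE uE vE sub1set !inE => /orP[]/eqP->; by rewrite eqxx.
Qed.

(** Stated for any [g] with support [S], so as to serve both from a cochain to a vertex set and
    back. *)
Lemma coboundary_cut (g : cochain K 0) (S : {set V}) :
  (forall s v, val s = [set v] -> (g s != 0) = (v \in S)) ->
  coboundary g = chi (cut S).
Proof.
move=> gS; apply/ffunP=> s; rewrite [RHS]ffunE.
have /eqP/cards2P[u [v [uv sE]]] := card_face s.
have [su uE] := @face_val 0 _ (vertex_in_complex u) (cards1 u).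
have [sv vE] := @face_val 0 _ (vertex_in_complex v) (cards1 v).
rewrite (@coboundary_edge g su sv); last by rewrite uE vE.
  rewrite sE cut_set2 // [g su]F2E [g sv]F2E (gS _ _ uE) (gS _ _ vE).
  by case: (u \in S); case: (v \in S); apply: val_inj.
by rewrite -val_eqE uE vE; apply: contra uv => /eqP/set1_inj->.
Qed.

Lemma im_coboundary0 (f : cochain K 1) :
  (f \in (@coboundary n K 0 @* [set: cochain K 0])%g) = [exists S, f == chi (cut S)].
Proof.
apply/morphimP/existsP=> [[g _ _ ->]|[S /eqP->]].
  exists [set v | [exists s : face K 0, (val s == [set v]) && (g s != 0)]].
  apply/eqP; apply: coboundary_cut => s v sE; rewrite inE; apply/idP/existsP.
    by move=> gs; exists s; rewrite sE eqxx.
  by case=> s' /andP[/eqP s'E]; rewrite (_ : s' = s) //; apply: val_inj; rewrite s'E.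
(* On a singleton face, not being disjoint from [S] means that its vertex lies in [S]. *)
pose g : cochain K 0 := [ffun s : face K 0 => (~~ [disjoint val s & S])%:R].
exists g; rewrite ?inE //; apply/esym/coboundary_cut => s v sE.
by rewrite ffunE sE disjoints1 negbK; case: (v \in S).
Qed.

Lemma ker_coboundary1 (G : {set {set V}}) : G \subset edges n ->
  (chi G \in 'ker (@coboundary n K 1))%g = [disjoint A & odd_triangles G].
Proof.
move=> sG; apply/kerP/pred0P=> [|/ffunP E t /=|E]; first exact: in_setT.
  apply/negP=> /andP[tA]; rewrite inE => odt.
  have tK : val t \in K by rewrite complex_ofE imset_f ?orbT.
  have [s sE] := @face_val 2 _ tK (card_val_triangle t).
  by have := E s; rewrite coboundary_chi // sE odt ffunE => /(congr1 val).
apply/ffunP=> s; rewrite coboundary_chi // [RHS]ffunE.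
have [t tA ->] := face2P s; have := E t; rewrite /= tA inE /= => ->.
by [].
Qed.

Lemma H1_trivial : (H1 K == 1%g) = [forall G, ~~ nontrivial_cocycle A G].
Proof.
(* In an abelian group the image is normalized by the kernel, so the quotient is trivial exactly
   when the kernel lies in the image. *)
have ab : abelian [set: cochain K 1].
  by apply/centsP=> f _ g _; apply: addrC.
have -> : (H1 K == 1%g) = ('ker (@coboundary n K 1) \subset @coboundary n K 0 @* setT)%g.
  rewrite -quotient_sub1; first by rewrite eqEsubset sub1G andbT.
  by apply: subset_trans (subsetT _) _; apply: sub_abelian_norm ab (subsetT _).
apply/subsetP/forallP=> [H G|H f fk].
  apply/and3P=> -[sG dG /forallP nG].
  have := H (chi G); rewrite ker_coboundary1 // dG => /(_ isT).
  rewrite im_coboundary0 => /existsP[S /eqP/chi_inj E].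
  by have := nG S; rewrite E ?eqxx ?cut_sub.
have [G sG fE] := chi_surj f; rewrite fE ker_coboundary1 // in fk *.
have := H G; rewrite /nontrivial_cocycle sG fk /= => /forallPn[S].
by rewrite negbK im_coboundary0 => /eqP GE; apply/existsP; exists S; rewrite -GE.
Qed.

End FirstCohomology.

(** * Hitting times *)

Section HittingTimes.
Variable n : nat.
Notation V := 'I_n.
Implicit Types (G : {set {set V}}) (e : {set V}) (A : {set triangle n}).
Implicit Types (w : outcome n).

Definition cofaces e : {set triangle n} := [set t : triangle n | e \subset val t].

(** The properties of a minimal nontrivial cocycle that do not mention the random triangles, so that
    a union bound can run over a fixed family. A single edge is excluded: it would be an isolated
    edge. *)
Definition obstruction G :=
  [&& G \subset edges n, 1 < #|G|, connected_graph G
    & n * #|G| <= 3 * #|odd_triangles G|].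

Lemma isolated_edgeE A e :
  isolated_edge (complex_of A) e = (e \in edges n) && [disjoint A & cofaces e].
Proof.
rewrite /isolated_edge complex_ofE inE; case e2: (#|e| == 2); last by rewrite andbF.
rewrite (eqP e2) /=; apply/forall_inP/pred0P=> [H t /=|H t].
  apply/negP=> /andP[tA]; rewrite inE => et; have := H (val t).
  by rewrite complex_ofE imset_f // orbT card_val_triangle et => /(_ isT).
rewrite complex_ofE => /orP[/andP[_ t2]|/imsetP[s sA ->]].
  by apply/implyP=> /eqP t3; rewrite t3 in t2.
by apply/implyP=> _; have := H s; rewrite /= sA inE /= => ->.
Qed.

Lemma odd_triangles1 e : odd_triangles [set e] = cofaces e.
Proof.
apply/setP=> t; rewrite !inE /odd_face.
have -> : [set f : {set V} in [set e] | f \subset val t] =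
          if e \subset val t then [set e] else set0.
  apply/setP=> f; case: ifP => et; rewrite !inE; case: eqP => // ->; apply: et.
by case: (e \subset val t); rewrite ?cards1 ?cards0.
Qed.

(** For a third vertex [x], the triangle on [u], [v], [x] contains exactly one edge of the set,
    whereas a cut meets it in an even number. *)
Lemma isolated_nontrivial A e : 2 < n -> isolated_edge (complex_of A) e ->
  nontrivial_cocycle A [set e].
Proof.
move=> n2; rewrite isolated_edgeE => /andP[eE dA].
rewrite /nontrivial_cocycle sub1set eE odd_triangles1 dA /=.
apply/forallP=> S; apply/eqP=> eS; have /edgesP[u [v [uv euv]]] := eE.
have : 0 < #|~: [set u; v]| by rewrite cardsCs setCK cards2 uv card_ord subn_gt0.
case/card_gt0P=> x; rewrite !inE negb_or => /andP[xu xv].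
have [] := set2_neq uv (_ : v != x) (_ : u != x); rewrite 1?eq_sym // => n1 n2' _.
have cutE y z : y != z -> ([set y; z] == [set u; v]) = (y \in S) (+) (z \in S).
  by move=> yz; rewrite -cut_set2 // -eS euv inE.
have := cutE _ _ uv; have := cutE u x; have := cutE v x.
rewrite !(eq_sym _ x) xu xv => /(_ isT) + /(_ isT).
rewrite (negPf n1) (eq_sym [set u; x]) (negPf n2') eqxx.
by do ![case: (_ \in _)].
Qed.

Lemma H1_trivial_no_isolated A : 2 < n -> H1 (complex_of A) == 1%g ->
  [forall e, ~~ isolated_edge (complex_of A) e].
Proof.
move=> n2; rewrite H1_trivial => /forallP H; apply/forallP=> e.
by apply: contra (H [set e]); apply: isolated_nontrivial.
Qed.

Lemma added_mono w m m' : m <= m' -> added w m \subset added w m'.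
Proof.
move=> le; apply/subsetP=> t; rewrite !inE -(take_takel _ le); exact: mem_take.
Qed.

(** Take a nontrivial cocycle with the fewest edges. With one edge, that edge would be isolated;
    with none, it would be [cut set0]. *)
Lemma exists_obstruction A : [forall e, ~~ isolated_edge (complex_of A) e] ->
  H1 (complex_of A) != 1%g ->
  exists2 G, obstruction G & [disjoint A & odd_triangles G].
Proof.
move=> /forallP noiso; rewrite H1_trivial => /forallPn[G0]; rewrite negbK => nG0.
case: (@arg_minnP _ G0 (nontrivial_cocycle A) (fun G => #|G|) nG0) => G nG minG.
have /and3P[sG dG /forallP ncut] := nG; exists G => //.
rewrite /obstruction sG (min_cocycle_connected nG minG) (card_odd_triangles nG minG).
rewrite !andbT /= ltnNge; apply/negP; rewrite leq_eqVlt ltnS leqn0.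
case/orP=> [/cards1P[e GE]|/eqP/cards0_eq G0E].
  have := noiso e; rewrite isolated_edgeE.
  by move: dG sG; rewrite GE odd_triangles1 sub1set => -> ->.
have := ncut set0; rewrite G0E => /eqP; apply; apply/esym/setP=> e.
by rewrite !inE set0I cards0 andbF.
Qed.

(** If [M <= M1 w], the odd triangles of an obstruction missing at time [M1 w] are also missing at
    time [M]; if [M1 w < M], no edge is isolated any more at time [M]. *)
Lemma M1_neq_M3 w M : 2 < n -> M1 w != M3 w ->
  [forall e in edges n, ~~ [disjoint added w M & cofaces e]] \/
  (exists2 G, obstruction G & [disjoint added w M & odd_triangles G]).
Proof.
move=> n2; rewrite /M1 /M3 /hitting_time.
set p1 := (fun m => [forall e, ~~ isolated_edge (Y w m) e]).
set p3 := (fun m => H1 (Y w m) == 1%g); set s := iota _ _.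
(* Vanishing cohomology excludes isolated edges, so [M1 w <= M3 w], and the inequality is strict
   here. *)
have sub31 : subpred p3 p1 by move=> m; apply: H1_trivial_no_isolated.
have le13 := sub_find sub31 s; rewrite neq_ltn [X in _ || X]ltnNge le13 orbF => lt13.
(* Being below [M3 w], the index [M1 w] is not the not-found value of [find], so there is no
   isolated edge at that time. *)
have ltN : find p1 s < size s by apply: leq_trans lt13 (find_size _ _).
have nthE : nth 0 s (find p1 s) = find p1 s.
  by rewrite nth_iota // -[X in _ < X](size_iota 0).
have iso1 : p1 (find p1 s) by rewrite -[X in p1 X]nthE nth_find // has_find.
have h13 : ~~ p3 (find p1 s) by rewrite -[X in p3 X]nthE before_find.
have [Mle|ltM] := leqP M (find p1 s).
  have [G oG dG] := exists_obstruction iso1 h13; right; exists G => //.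
  exact: disjointWl (added_mono w Mle) dG.
left; apply/forall_inP=> e eE; move/forallP/(_ e): iso1.
rewrite isolated_edgeE eE /=; apply: contra.
exact: disjointWl (added_mono w (ltnW ltM)).
Qed.

End HittingTimes.

(** * The law of the process *)

Section Counting.

Lemma ffactnD n a b : n ^_ (a + b) = n ^_ a * (n - a) ^_ b.
Proof.
elim: b => [|b IHb]; first by rewrite addn0 muln1.
by rewrite addnS !ffactnSr IHb mulnA subnDA.
Qed.

(** The first [a] entries form an injective word over [A], the last [b] one over the complement of
    the entries already used. *)
Lemma card_uniq_cat (T : finType) (A : {set T}) a b :
  #|[set w : (a + b).-tuple T | uniq w & all (mem A) (take a w)]| =
  #|A| ^_ a * (#|T| - a) ^_ b.
Proof.
pose cat2 (p : a.-tuple T * b.-tuple T) : (a + b).-tuple T := [tuple of p.1 ++ p.2].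
have cat2_bij : bijective cat2.
  apply: inj_card_bij; last by rewrite card_prod !card_tuple expnD.
  move=> [s1 s2] [t1 t2] /(congr1 val) /= /eqP.
  rewrite eqseq_cat ?size_tuple // => /andP[/eqP e1 /eqP e2].
  by congr (_, _); apply: val_inj.
rewrite -sum1_card (reindex cat2) /=; last by apply: onW_bij.
rewrite (eq_bigl (fun p : a.-tuple T * b.-tuple T => (uniq p.1 && all (mem A) p.1)
     && (all (mem (~: [set x in p.1])) p.2 && uniq p.2))); last first.
  move=> [s1 s2]; rewrite inE /= take_size_cat ?size_tuple // cat_uniq.
  have -> : has (mem s1) s2 = ~~ all (mem (~: [set x in s1])) s2.
    by rewrite -has_predC; apply: eq_has => x; rewrite /= !inE negbK.
  by rewrite negbK; case: (uniq s1); case: (uniq s2); case: (all (mem A) s1);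
    rewrite ?andbT ?andbF.
rewrite -(pair_big_dep (fun s1 : a.-tuple T => uniq s1 && all (mem A) s1)
  (fun s1 (s2 : b.-tuple T) => all (mem (~: [set x in s1])) s2 && uniq s2)
  (fun _ _ => 1)) /=.
transitivity (\sum_(s1 : a.-tuple T | uniq s1 && all (mem A) s1) (#|T| - a) ^_ b).
  apply: eq_bigr => s1 /andP[us1 _].
  rewrite sum1dep_card card_uniq_tuples; congr (_ ^_ _).
  rewrite -[LHS]/(#|~: [set x in s1]|) cardsCs setCK; congr (_ - _).
  by rewrite cardsE (card_uniqP us1) size_tuple.
rewrite sum_nat_const; congr (_ * _).
rewrite -(card_uniq_tuples a (mem A)) cardsE; apply: eq_card => s.
by rewrite [RHS]inE andbC.
Qed.

Lemma card_triangle n : #|{: triangle n}| = 'C(n, 3).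
Proof.
rewrite card_sig -[n in RHS]card_ord -card_draws cardsE.
by apply: eq_card.
Qed.

Lemma card_avoid n (B : {set triangle n}) M : M <= 'C(n, 3) ->
  #|[set w : outcome n | uniq w & [disjoint added w M & B]]| =
  ('C(n, 3) - #|B|) ^_ M * ('C(n, 3) - M)`!.
Proof.
move=> leM; have NE : 'C(n, 3) = M + ('C(n, 3) - M) by rewrite subnKC.
transitivity (#|[set w : (M + ('C(n, 3) - M)).-tuple (triangle n) |
                  uniq w & all (mem (~: B)) (take M w)]|); last first.
  by rewrite card_uniq_cat cardsCs setCK card_triangle -ffactnn.
rewrite -NE; apply: eq_card => w; rewrite !inE; congr (_ && _).
rewrite disjoint_subset; apply/subsetP/allP => H t; have := H t; rewrite !inE //.
Qed.

End Counting.

(** * Probabilities under the uniform law on orderings *)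

Section Probability.
Import Order.TTheory GRing.Theory Num.Theory.
Local Open Scope ring_scope.
Variables (R : realFieldType) (n : nat).
Notation N := ('C(n, 3)).
Implicit Types (E : pred (outcome n)) (w : outcome n) (B : {set triangle n}).

(** The factors [1 / (N - i)] multiply to [1 / N!], and a repetition makes one factor zero. *)
Lemma outcome_probE w :
  outcome_prob R w = if uniq w then (N`!%:R)^-1 else 0.
Proof.
have szw : size w = N by rewrite size_tuple.
have tnthE (i : 'I_N) : tnth w i = nth (tnth w i) w i by apply: tnth_nth.
have addedE (i : 'I_N) : (tnth w i \in added w i) = (index (tnth w i) w < i)%N.
  by rewrite inE in_take ?mem_tnth.
case: ifP => [uw|/negbT nuw]; rewrite /outcome_prob.
  rewrite (eq_bigr (fun i : 'I_N => ((N - i)%N%:R)^-1)) => [|i _].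
    by rewrite prodfV -natr_prod -ffact_prod ffactnn.
  by rewrite /step_prob addedE [in index _]tnthE index_uniq ?szw ?ltnn.
(* A tuple with a repetition is nonempty, which supplies a default triangle. *)
have [t0 _|T0] := pickP (fun t : triangle n => true); last first.
  by case: (tval w) nuw => // t; have := T0 t.
have /(uniqPn t0)[i [j [ij jN eqij]]] := nuw; rewrite szw in jN.
apply/eqP; rewrite prodf_seq_eq0; apply/hasP; exists (Ordinal jN); first exact: mem_index_enum.
rewrite /step_prob inE (tnth_nth t0) /= -eqij -(nth_take t0 ij) mem_nth //.
by rewrite size_takel // szw ltnW.
Qed.

Lemma prob_ge0 E : 0 <= prob R E.
Proof.
apply: sumr_ge0 => w _; rewrite outcome_probE; case: ifP => // _.
by rewrite invr_ge0.
Qed.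

Lemma prob_le E E' : (forall w, E w -> E' w) -> prob R E <= prob R E'.
Proof.
move=> sEE'; rewrite /prob big_mkcond [leRHS]big_mkcond; apply: ler_sum => w _.
have w0 : 0 <= outcome_prob R w.
  by rewrite outcome_probE; case: ifP => // _; rewrite invr_ge0.
by case: ifP => [/sEE'->//|_]; case: ifP.
Qed.

Lemma prob_setU E E' : prob R (fun w => E w || E' w) <= prob R E + prob R E'.
Proof.
rewrite /prob big_mkcond [X in _ <= X + _]big_mkcond [X in _ <= _ + X]big_mkcond -big_split.
apply: ler_sum => w _; have w0 : 0 <= outcome_prob R w.
  by rewrite outcome_probE; case: ifP => // _; rewrite invr_ge0.
by case: (E w); case: (E' w); rewrite /= ?addr0 ?add0r // lerDl.
Qed.

Lemma prob_exists (I : finType) (P : pred I) (F : I -> pred (outcome n)) :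
  prob R (fun w => [exists i, P i && F i w]) <= \sum_(i | P i) prob R (F i).
Proof.
rewrite /prob (eq_bigr (fun i => \sum_w (if F i w then outcome_prob R w else 0))); last first.
  by move=> i _; rewrite big_mkcond.
rewrite exchange_big /= big_mkcond; apply: ler_sum => w _.
have w0 : 0 <= outcome_prob R w.
  by rewrite outcome_probE; case: ifP => // _; rewrite invr_ge0.
have sum0 (Q : pred I) : 0 <= \sum_(i | Q i) (if F i w then outcome_prob R w else 0).
  by apply: sumr_ge0 => i _; case: ifP.
case: ifP => // /existsP[i /andP[Pi Fi]]; rewrite (bigD1 i) //= Fi lerDl.
by apply: sumr_ge0 => j _; case: ifP.
Qed.

Lemma prob_card E : prob R E = #|[set w : outcome n | uniq w & E w]|%:R / (N`!)%:R.
Proof.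
rewrite /prob big_mkcond; under eq_bigr => w _ do rewrite outcome_probE -if_and andbC.
by rewrite -big_mkcond sumr_const -[LHS]mulr_natl cardsE.
Qed.

(** The count of orderings is a falling factorial of length [M]. Factoring [N ^_ (M + #|B|)] in both
    orders turns it into one of length [#|B|]. *)
Lemma prob_avoid M B : (M <= N)%N ->
  prob R (fun w => [disjoint added w M & B]) =
  ((N - M) ^_ #|B|)%:R / (N ^_ #|B|)%:R.
Proof.
move=> leM; have leB : (#|B| <= N)%N by rewrite -card_triangle max_card.
have fNM := ffact_fact leM.
rewrite prob_card card_avoid //; apply/eqP.
rewrite eqr_div ?pnatr_eq0 -?lt0n ?fact_gt0 ?ffact_gt0 // -!natrM eqr_nat -fNM; apply/eqP.
rewrite mulnAC [RHS]mulnA; congr (_ * _)%N.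
by rewrite mulnC -ffactnD addnC ffactnD mulnC.
Qed.

Lemma prob_setT : prob R (predT : pred (outcome n)) = 1.
Proof.
rewrite prob_card (_ : #|_| = N`!) ?divff ?pnatr_eq0 -?lt0n ?fact_gt0 //.
rewrite -[in RHS]ffactnn -[in X in X ^_ _]card_triangle -cardsT -card_uniq_tuples.
apply: eq_card => w; rewrite !inE andbT.
by have -> : all (mem [set: triangle n]) w by apply/allP=> t _; rewrite /= inE.
Qed.

Lemma probC E : prob R (fun w => ~~ E w) = 1 - prob R E.
Proof.
rewrite -prob_setT /prob [X in _ = X - _](bigID E) /= [X in X - _]addrC addrK.
by apply: eq_bigl => w.
Qed.




(** Chebyshev's inequality, cleared of denominators: with [X] the number of events that occur,
    [(X - m) ^+ 2] equals [m ^+ 2] wherever [X] vanishes. *)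
Lemma second_moment (I : finType) (P : pred I) (F : I -> pred (outcome n)) m :
  \sum_(i in P) prob R (F i) = m ->
  prob R (fun w => [forall i in P, ~~ F i w]) * m ^+ 2 <=
  \sum_(i in P) \sum_(j in P) prob R (fun w => F i w && F j w) - m ^+ 2.
Proof.
move=> mE; pose X w : R := \sum_(i in P) (F i w)%:R.
pose mu w := outcome_prob R w.
have mu0 w : 0 <= mu w.
  by rewrite /mu outcome_probE; case: ifP => // _; rewrite invr_ge0.
have probE E : prob R E = \sum_w mu w * (E w)%:R.
  by rewrite /prob big_mkcond; apply: eq_bigr => w _; case: (E w); rewrite ?mulr1 ?mulr0.
have EX : \sum_w mu w * X w = m.
  rewrite -mE (eq_bigr _ (fun i _ => probE (F i))) exchange_big /=.
  by apply: eq_bigr => w _; rewrite -mulr_sumr.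
have EXX : \sum_w mu w * X w ^+ 2 =
    \sum_(i in P) \sum_(j in P) prob R (fun w => F i w && F j w).
  rewrite (eq_bigr _ (fun i _ => eq_bigr _ (fun j _ => probE (fun w => F i w && F j w)))).
  under eq_bigr => i _ do rewrite exchange_big /=.
  rewrite exchange_big /=; apply: eq_bigr => w _.
  rewrite expr2 /X mulr_suml mulr_sumr; apply: eq_bigr => i _.
  rewrite -mulr_sumr; congr (_ * _); rewrite mulr_sumr; apply: eq_bigr => j _.
  by case: (F i w); case: (F j w); rewrite ?mulr0 ?mulr1 ?mul0r.
have E1 : \sum_w mu w = 1.
  by rewrite -prob_setT probE; apply: eq_bigr => w _; rewrite mulr1.
have var : \sum_w mu w * (X w - m) ^+ 2 =
    \sum_(i in P) \sum_(j in P) prob R (fun w => F i w && F j w) - m ^+ 2.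
  rewrite -EXX (eq_bigr (fun w =>
    mu w * X w ^+ 2 - 2 * m * (mu w * X w) + m ^+ 2 * mu w)); last first.
    by move=> w _; ring.
  rewrite big_split sumrB /= -!mulr_sumr EX E1; ring.
rewrite -var probE mulr_suml; apply: ler_sum => w _; rewrite -mulrA.
apply: ler_wpM2l => //; case: (boolP [forall i in P, ~~ F i w]) => [/forall_inP H|_];
  last by rewrite mul0r sqr_ge0.
rewrite mul1r /X big1 ?sub0r ?sqrrN // => i Pi.
by rewrite (negPf (H i Pi)).
Qed.

End Probability.

(** * Triangles containing a given edge *)

Section Cofaces.
Variable n : nat.
Implicit Types e f : {set 'I_n}.

Lemma card_cofaces e : e \in edges n -> #|cofaces e| = (n - 2)%N.
Proof.
rewrite inE => /eqP e2; rewrite -(card_imset _ val_inj).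
have -> : [set val t | t in cofaces e] = [set w |: e | w in ~: e].
  apply/setP=> s; apply/imsetP/imsetP=> [[t + ->]|[w + ->]]; rewrite inE => h.
    have : #|val t :\: e| == 1%N.
      by rewrite cardsD (setIidPr h) card_val_triangle e2.
    case/cards1P=> w wE; have : w \in val t :\: e by rewrite wE set11.
    rewrite inE => /andP[we wt]; exists w; rewrite ?inE //.
    by rewrite -wE setDE setUIl setUC (setUidPr h) [~: e :|: e]setUC setUCr setIT.
  have [|t tE] := @triangle_val n (w |: e); first by rewrite cardsU1 h e2.
  by exists t => //; rewrite inE tE subsetUr.
rewrite card_in_imset => [|w w']; first by rewrite cardsCs setCK e2 card_ord.
rewrite !inE => we w'e /setP/(_ w); rewrite !inE eqxx (negPf we) orbF.
by rewrite orbF => /esym/eqP.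
Qed.

(** A common coface contains [e :|: f], which has four vertices if the edges are disjoint and
    otherwise is itself that coface. *)
Lemma card_cofacesI e f : e \in edges n -> f \in edges n -> e != f ->
  (#|cofaces e :&: cofaces f| <= ~~ [disjoint e & f])%N.
Proof.
rewrite !inE => /eqP e2 /eqP f2 ef.
have UE t : t \in cofaces e :&: cofaces f -> e :|: f \subset val t.
  by rewrite !inE subUset.
have cU : (#|e :|: f| + #|e :&: f| = 4)%N by rewrite cardsUI e2 f2.
have [dis|_] /= := boolP [disjoint e & f].
  rewrite leqn0 cards_eq0; apply/set0Pn=> -[t /UE/subset_leq_card].
  by rewrite card_val_triangle; move: cU; rewrite (disjoint_setI0 dis) cards0; lia.
have cU3 : (2 < #|e :|: f|)%N.
  rewrite ltnNge -e2; apply: contra ef => le2.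
  have /eqP fE : e == e :|: f by rewrite eqEcard subsetUl le2.
  by rewrite eq_sym eqEcard e2 f2 leqnn andbT fE subsetUr.
apply/card_le1_eqP=> t t' /UE tE /UE t'E; apply: val_inj.
have eqU (s : triangle n) : e :|: f \subset val s -> val s = e :|: f.
  by move=> sE; apply/esym/eqP; rewrite eqEcard sE card_val_triangle.
by rewrite (eqU _ tE) (eqU _ t'E).
Qed.

End Cofaces.

(** * The probability that given triangles are missing *)

Section Avoidance.
Import Order.TTheory GRing.Theory Num.Theory.
Local Open Scope ring_scope.
Variables (R : realFieldType) (N M : nat).

(** For [i < N], the conditional probability that a further triangle is missing at time [M] when [i]
    given ones are; at [i = 0] this is the density [x]. Their product is [avoid]. *)
Definition avoid_ratio i : R := (N - M - i)%N%:R / (N - i)%N%:R.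
Definition avoid b : R := ((N - M) ^_ b)%:R / (N ^_ b)%:R.

Lemma avoid0 : avoid 0 = 1.
Proof. by rewrite /avoid !ffactn0 divr1. Qed.

Lemma avoidS b : avoid b.+1 = avoid b * avoid_ratio b.
Proof. by rewrite /avoid /avoid_ratio !ffactnSr !natrM invfM mulrACA. Qed.

Lemma ratio_ge0 i : 0 <= avoid_ratio i.
Proof. by rewrite divr_ge0. Qed.

Lemma avoid_ge0 b : 0 <= avoid b.
Proof. by rewrite divr_ge0. Qed.

Lemma ratio_antitone i j : (i <= j)%N -> avoid_ratio j <= avoid_ratio i.
Proof.
(* From [N - M] on, the truncated numerator is zero; below it, both denominators are positive. *)
move=> ij; have [le|lt] := leqP (N - M) j.
  by rewrite /avoid_ratio (eqP le) mul0r ratio_ge0.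
rewrite /avoid_ratio ler_pdivrMr ?ltr0n ?subn_gt0; last by lia.
rewrite mulrAC ler_pdivlMr ?ltr0n ?subn_gt0; last by lia.
rewrite -!natrM ler_nat.
have -> : (N - M - i = (N - M - j) + (j - i))%N by lia.
have -> : (N - i = (N - j) + (j - i))%N by lia.
have : (N - M - j <= N - j)%N by lia.
by nia.
Qed.

Lemma ratio_le1 i : avoid_ratio i <= 1.
Proof.
apply: le_trans (ratio_antitone (leq0n i)) _; rewrite /avoid_ratio !subn0.
have [->|N0] := posnP N; first by rewrite mul0r.
by rewrite ler_pdivrMr ?ltr0n // mul1r ler_nat leq_subr.
Qed.

(** Negative correlation, because the ratios decrease. *)
Lemma avoid_le_mul a b : avoid (a + b) <= avoid a * avoid b.
Proof.
elim: b => [|b IHb]; first by rewrite addn0 avoid0 mulr1.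
rewrite addnS !avoidS mulrA; apply: ler_pM => //; rewrite ?avoid_ge0 ?ratio_ge0 //.
exact: ratio_antitone (leq_addl _ _).
Qed.

Lemma avoid_le_expr b : avoid b <= avoid_ratio 0 ^+ b.
Proof.
elim: b => [|b IHb]; first by rewrite avoid0 expr0.
rewrite avoidS exprSr; apply: ler_pM => //; rewrite ?avoid_ge0 ?ratio_ge0 //.
exact: ratio_antitone.
Qed.

Lemma avoid_ge_expr b : avoid_ratio b ^+ b <= avoid b.
Proof.
suff H j : (j <= b)%N -> avoid_ratio b ^+ j <= avoid j by exact: H.
elim: j => [|j IHj] jb; first by rewrite avoid0 expr0.
rewrite avoidS exprSr; apply: ler_pM; rewrite ?exprn_ge0 ?ratio_ge0 //.
  exact: IHj (ltnW jb).
exact: ratio_antitone (ltnW jb).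
Qed.

Lemma avoid_le1 b : avoid b <= 1.
Proof. by apply: le_trans (avoid_le_expr b) _; rewrite exprn_ile1 ?ratio_ge0 ?ratio_le1. Qed.

Lemma avoid_antitone a b : (a <= b)%N -> avoid b <= avoid a.
Proof.
move=> ab; rewrite -(subnKC ab); apply: le_trans (avoid_le_mul _ _) _.
by rewrite ler_piMr ?avoid_ge0 ?avoid_le1.
Qed.

End Avoidance.

(** * Isolated edges by the second moment method *)

Section Isolated.
Import Order.TTheory GRing.Theory Num.Theory.
Local Open Scope ring_scope.
Variables (R : realFieldType) (n M : nat).
Notation N := ('C(n, 3)).
Notation avoid := (avoid R N M).
Notation avoid_ratio := (avoid_ratio R N M).

(** With [q] the probability that an edge is isolated, a pair of edges contributes at most [q ^+ 2]
    if disjoint, [4 * q ^+ 2] if meeting and [q] if equal. At most [2 * n] edges meet a given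
    one. *)
Lemma prob_no_isolated : (2 < n)%N -> (M <= N)%N -> 4^-1 <= avoid_ratio n ->
  prob R (fun w : outcome n => [forall e in edges n, ~~ [disjoint added w M & cofaces e]])
    <= ('C(n, 2)%:R * avoid (n - 2))^-1 + (8 * n)%:R / 'C(n, 2)%:R.
Proof.
move=> n2 leM r4; pose isolated e (w : outcome n) := [disjoint added w M & cofaces e].
set q := avoid (n - 2); set K : R := 'C(n, 2)%:R.
have ratio4 i : (i <= n)%N -> 4^-1 <= avoid_ratio i.
  by move=> le; apply: le_trans r4 (ratio_antitone _ _ _ le).
have q0 : 0 < q.
  apply: lt_le_trans (avoid_ge_expr _ _ _ _); apply: exprn_gt0.
  by apply: lt_le_trans (ratio4 _ (leq_subr _ _)); rewrite invr_gt0.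
have K0 : 0 < K by rewrite ltr0n bin_gt0 ltnW.
(* Two meeting edges may share a triangle; having one triangle fewer to avoid costs a factor of at
   most 4. *)
have q3 : avoid (n - 3) <= 4 * q.
  have nE : (n - 2 = (n - 3).+1)%N by lia.
  rewrite /q nE avoidS mulrCA ler_peMr ?avoid_ge0 //.
  by have := ratio4 (n - 3)%N (leq_subr _ _); lra.
have pF e : e \in edges n -> prob R (isolated e) = q.
  by move=> eE; rewrite prob_avoid // card_cofaces.
have mE : \sum_(e in edges n) prob R (isolated e) = K * q.
  by rewrite (eq_bigr _ pF) sumr_const card_edges -mulr_natl.
have pFF e f : e \in edges n -> f \in edges n ->
    prob R (fun w : outcome n => isolated e w && isolated f w)
    <= q ^+ 2 + (if f \in grow [set e] then 4 * q ^+ 2 else 0) + (if f == e then q else 0).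
  move=> eE fE; have [->|fe] := eqVneq f e.
    apply: (@le_trans _ _ q); last first.
      rewrite lerDr addr_ge0 ?sqr_ge0 //.
      by case: ifP => // _; rewrite mulr_ge0 ?sqr_ge0.
    by rewrite -(pF e eE); apply: prob_le => w /andP[].
  have cU : #|cofaces e :|: cofaces f| = ((n - 2) + (n - 2) - #|cofaces e :&: cofaces f|)%N.
    by rewrite cardsU !card_cofaces.
  have cI := card_cofacesI eE fE; rewrite eq_sym fe in cI; have {}cI := cI isT.
  have -> : prob R (fun w : outcome n => isolated e w && isolated f w)
      = avoid #|cofaces e :|: cofaces f|.
    transitivity (prob R (fun w : outcome n =>
        [disjoint added w M & cofaces e :|: cofaces f])).
      by apply: eq_bigl => w; rewrite /isolated -!setI_eq0 setIUr setU_eq0.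
    by rewrite prob_avoid.
  rewrite addr0 cU; have [dis|adj] := boolP [disjoint e & f].
    move: cI; rewrite dis leqn0 => /eqP ->; rewrite subn0.
    apply: le_trans (avoid_le_mul _ _ _ _ _) _; rewrite -expr2 lerDl.
    by case: ifP => // _; rewrite mulr_ge0 ?sqr_ge0.
  have -> : f \in grow [set e].
    by rewrite inE fE; apply/exists_inP; exists e; rewrite ?inE // disjoint_sym.
  apply: (@le_trans _ _ (4 * q ^+ 2)); last by rewrite lerDr sqr_ge0.
  apply: (@le_trans _ _ (avoid ((n - 3) + (n - 2)))).
    by apply: avoid_antitone; move: cI; clear -n2; case: (~~ _) => /=; lia.
  apply: le_trans (avoid_le_mul _ _ _ _ _) _.
  by rewrite expr2 mulrA ler_wpM2r // ltW.
have ss : \sum_(e in edges n) \sum_(f in edges n)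
      prob R (fun w : outcome n => isolated e w && isolated f w)
    <= K * (K * q ^+ 2 + (8 * n)%:R * q ^+ 2 + q).
  rewrite {1}/K -card_edges mulr_natl -sumr_const; apply: ler_sum => e eE.
  apply: (@le_trans _ _ (\sum_(f in edges n) (q ^+ 2 +
      (if f \in grow [set e] then 4 * q ^+ 2 else 0) + (if f == e then q else 0)))).
    by apply: ler_sum => f fE; apply: pFF.
  rewrite !big_split /= sumr_const card_edges -mulr_natl -/K.
  apply: lerD; first apply: lerD => //; last first.
    rewrite -big_mkcondr /= (big_pred1 e) // => f /=.
    by case: eqP => [->|]; rewrite ?eE ?andbF.
  rewrite -big_mkcondr /= sumr_const -[leLHS]mulr_natl mulrA ler_wpM2r ?sqr_ge0 //.
  rewrite mulr1 -natrM ler_nat; apply: (@leq_trans (#|grow [set e]| * 4)).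
    by rewrite leq_mul2r; apply/orP; right; apply: subset_leq_card;
       apply/subsetP=> f; rewrite unfold_in => /andP[].
  have := @card_grow n [set e]; rewrite sub1set => /(_ eE); rewrite cards1; lia.
  by rewrite mulr_natl.
have Kq0 : 0 < (K * q) ^+ 2 by rewrite exprn_gt0 // mulr_gt0 // ltW.
have := second_moment mE; rewrite -ler_pdivlMr // => pr.
apply: le_trans pr _; rewrite ler_pdivrMr //.
rewrite lerBlDr; apply: le_trans ss _; rewrite le_eqVlt; apply/orP; left; apply/eqP.
by field; rewrite !gt_eqF.
Qed.

End Isolated.

(* Imported only here: many lemmas of [finset] are shadowed by [classical_sets]. *)
From mathcomp Require Import all_classical all_reals all_analysis.

(** * The union bound over cocycles *)

Section UnionBound.
Import Order.TTheory GRing.Theory Num.Theory.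
Local Open Scope ring_scope.

Lemma sum_by_nat (R : nmodType) (T : finType) (P : pred T) (f : T -> nat) (W : T -> R) m :
  (forall x, P x -> (f x <= m)%N) ->
  \sum_(x | P x) W x = \sum_(k < m.+1) \sum_(x | P x && (f x == k)) W x.
Proof.
move=> fm; rewrite (partition_big (fun x => inord (f x) : 'I_m.+1) predT) //=.
apply: eq_bigr => k _; apply: eq_bigl => x; apply: andb_id2l => /fm fx.
by rewrite -val_eqE /= inordK.
Qed.

Lemma bin_fact_le m l : ('C(m, l) * l`! <= m ^ l)%N.
Proof.
rewrite bin_ffact ffact_prod -[X in (_ <= _ ^ X)%N]card_ord -prod_nat_const.
by apply: leq_prod => i _; apply: leq_subr.
Qed.

(** One term of the exponential series at [l]; this replaces Stirling's formula. *)
Lemma pow_self_le (R : realType) l : l%:R ^+ l <= l`!%:R * expR l%:R :> R.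
Proof.
case: l => [|l]; first by rewrite expr0 fact0 mul1r expR0.
have := @expR_ge1Dxn R l.+1%:R l (ler0n _ _).
rewrite -ler_pdivrMl ?ltr0n ?fact_gt0 // => h; apply: le_trans h.
by rewrite mulrC lerDr.
Qed.

Variables (R : realType) (n M : nat) (L : R).
Hypothesis nE : n%:R = expR L.
Notation N := ('C(n, 3)).
Notation avoid := (avoid R N M).
Notation D := (n %/ 50)%N.
Hypothesis n_large : (100 * 103 <= n)%N.
Hypothesis ratio_small : avoid_ratio R N M 0 ^+ n <= expR (- (15 / 8 * L)).

Let n_gt0 : 0 < n%:R :> R. Proof. by rewrite nE expR_gt0. Qed.

Let L_ge0 : 0 <= L.
Proof. by rewrite -ler_expR expR0 -nE ler1n; lia. Qed.

Let expR_mono (x y : R) : x <= y -> expR x <= expR y.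
Proof. by rewrite ler_expR. Qed.

(** The [n]-th root of [ratio_small] bounds each of the [b] factors. *)
Lemma avoid_expR b : avoid b <= expR (- (15 / 8 * L * b%:R / n%:R)).
Proof.
have n0 : (0 < n)%N by lia.
have r0 : avoid_ratio R N M 0 <= expR (- (15 / 8 * L / n%:R)).
  rewrite -(ler_pXn2r n0) ?nnegrE ?expR_ge0 ?ratio_ge0 // -expRM_natl.
  apply: le_trans ratio_small _; apply: expR_mono.
  by rewrite le_eqVlt; apply/orP; left; apply/eqP; field; rewrite gt_eqF.
apply: le_trans (avoid_le_expr _ _ _ _) _.
apply: (@le_trans _ _ (expR (- (15 / 8 * L / n%:R)) ^+ b)).
  by rewrite lerXn2r ?nnegrE ?expR_ge0 ?ratio_ge0.
rewrite -expRM_natl; apply: expR_mono.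
by rewrite le_eqVlt; apply/orP; left; apply/eqP; field; rewrite gt_eqF.
Qed.

Lemma avoid_expR_ge b (c : R) : c * n%:R <= b%:R -> avoid b <= expR (- (15 / 8 * L * c)).
Proof.
move=> cb; apply: le_trans (avoid_expR b) _; apply: expR_mono.
rewrite lerN2 -[leRHS]mulrA; apply: ler_wpM2l; first by rewrite mulr_ge0.
by rewrite ler_pdivlMr.
Qed.

(** Here 5/8 is 15/8 times the 1/3 of the Meshulam-Wallach bound. *)
Lemma avoid_obstruction (G : {set {set 'I_n}}) : obstruction G ->
  avoid #|odd_triangles G| <= expR (- (5 / 8 * L * #|G|%:R)).
Proof.
case/and4P=> _ _ _; rewrite -(ler_nat R) !natrM => h.
apply: le_trans (avoid_expR_ge (c := #|G|%:R / 3) _) _.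
  by rewrite mulrAC ler_pdivrMr ?ltr0n // mulrC [leRHS]mulrC.
by apply: expR_mono; lra.
Qed.

(** As [D <= n / 50], [n - 2 * D] is at least [24 / 25 * n], and 15/8 times 24/25 is 9/5. *)
Lemma avoid_low (G : {set {set 'I_n}}) : G \subset edges n ->
  avoid #|odd_triangles G| <= expR (- (9 / 5 * L * #|low D G|%:R)).
Proof.
move=> sG; have := card_odd_triangles_low D sG.
have : (#|low D G| * (24 * n) <= #|low D G| * (25 * (n - 2 * D)))%N.
  by rewrite leq_mul2l; apply/orP; right; lia.
rewrite -!(ler_nat R) !natrM => h1 h2.
apply: le_trans (avoid_expR_ge (c := 24 / 25 * #|low D G|%:R) _) _; first lra.
by apply: expR_mono; lra.
Qed.

Lemma sum_le_card (T : finType) (P : pred T) (F : T -> R) (c : R) :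
  (forall x, P x -> F x <= c) -> \sum_(x | P x) F x <= #|P|%:R * c.
Proof. by move=> Fc; rewrite mulr_natl -sumr_const; apply: ler_sum. Qed.

(** All edges are low, and [reach] counts the graphs. As [k] is at most the square root of [n], each
    edge after the first costs at most [expR (1 + 3 / 2 * L)] against a weight
    [expR (- (9 / 5 * L))]; the leftover [L / 2] is absorbed since [k >= 2]. *)
Lemma sum_small_obstructions k : (1 < k)%N -> (k * k <= n)%N ->
  \sum_(G : {set {set 'I_n}} | obstruction G && (#|G| == k)) avoid #|odd_triangles G|
  <= expR (k%:R * (405 - L / 40)).
Proof.
case: k => [|[|k]] // _ kn.
have le_W (G : {set {set 'I_n}}) : obstruction G && (#|G| == k.+2) ->
    avoid #|odd_triangles G| <= expR (- (9 / 5 * L * k.+2%:R)).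
  case/andP=> /and4P[sG _ _ _] /eqP Gk; have := avoid_low sG.
  suff -> : low D G = G by rewrite Gk.
  apply/eqP; rewrite finset.eqEsubset; apply/andP; split.
    by apply/fintype.subsetP=> e; rewrite finset.inE => /andP[].
  rewrite -finset.setD_eq0; apply/finset.set0Pn=> -[e /low_not_high[v _ vH]].
  have := card_high D sG; rewrite Gk.
  (* A high vertex would force [D <= 2 * k.+2]. This fails up to 100 edges because [n >= 100 * 103],
     and beyond because [n >= k.+2 ^ 2]. *)
  have : (0 < #|high D G|)%N by apply/card_gt0P; exists v.
  have [|] := leqP k.+2 100; nia.
apply: le_trans (sum_le_card le_W) _.
have : (#|[pred G : {set {set 'I_n}} | obstruction G && (#|G| == k.+2)]| <= #|reach n k.+1|)%N.
  apply: subset_leq_card; apply/fintype.subsetP=> G.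
  rewrite finset.inE => /andP[/and4P[sG _ cG _] /eqP Gk].
  exact: mem_reach.
move/leq_trans/(_ (card_reach n k.+1)); rewrite -(ler_nat R) !(natrM, natrX) => cnt.
apply: le_trans (ler_wpM2r (expR_ge0 _) cnt) _.
have two : 2 <= expR 1 :> R by have := expR_ge1Dx (1 : R); lra.
have kL : k.+1%:R <= expR (L / 2) :> R.
  rewrite -(@ler_pXn2r _ 2) ?nnegrE ?expR_ge0 // -expRM_natl.
  rewrite (_ : 2%:R * (L / 2) = L); last by field.
  by rewrite -nE -natrX ler_nat; lia.
apply: (@le_trans _ _ (expR (2 * L) * expR (1 + 3 / 2 * L) ^+ k.+1 *
                       expR (- (9 / 5 * L * k.+2%:R)))).
  rewrite ler_wpM2r ?expR_ge0 // ler_pM ?exprn_ge0 ?mulr_ge0 //.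
    by rewrite nE -expRM_natl.
  rewrite lerXn2r ?nnegrE ?expR_ge0 ?mulr_ge0 //.
  rewrite (_ : 1 + 3 / 2 * L = 1 + L / 2 + L); last by field.
  by rewrite !expRD nE !ler_pM ?expR_ge0 ?mulr_ge0.
rewrite -expRM_natl -!expRD; apply: expR_mono.
have k0 : 0 <= k%:R :> R by [].
have -> : k.+2%:R = k%:R + 2 :> R by rewrite -natrD addn2.
have -> : k.+1%:R = k%:R + 1 :> R by rewrite natr1.
have := mulr_ge0 L_ge0 k0; move: L_ge0; lra.
Qed.


Lemma card_profile_le h l : (#|[set G : {set {set 'I_n}} |
    [&& G \subset edges n, #|low D G| == l & (#|high D G| <= h)%N]]|%:R : R) <=
  expR (2 * n%:R * h%:R) * 'C('C(n, 2), l)%:R.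
Proof.
have two : 2 <= expR 1 :> R by have := expR_ge1Dx (1 : R); lra.
have n0 : (0 < n)%N by lia.
have := card_low_high D h l n0; rewrite -(ler_nat R) !(natrM, natrX) => cnt.
apply: le_trans cnt _; rewrite ler_wpM2r // expRM_natr.
rewrite lerXn2r ?nnegrE ?expR_ge0 ?mulr_ge0 ?exprn_ge0 //.
rewrite (_ : 2 * n%:R = n%:R + n%:R * 1); last by ring.
rewrite expRD expRM_natl ler_pM ?exprn_ge0 ?lerXn2r ?nnegrE ?expR_ge0 //.
by have := expR_ge1Dx (n%:R : R); lra.
Qed.

(** The factorial stays on the left: it is dropped when [l] is small and exploited when [l] is
    large. *)
Lemma bin_edges_le l : ('C('C(n, 2), l)%:R * l`!%:R : R) <= expR (2 * L * l%:R).
Proof.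
rewrite -natrM expRM_natr expRM_natl -nE -!natrX ler_nat.
apply: leq_trans (bin_fact_le _ _) _; case: l => // l; rewrite leq_exp2r //.
by rewrite bin2 -divn2 (leq_trans (leq_div _ _)) // -mulnn leq_mul2l leq_pred orbT.
Qed.

Lemma sum_profile k l : (n < k * k)%N -> (l <= k)%N ->
  \sum_(G : {set {set 'I_n}} | (obstruction G && (#|G| == k)) && (#|low D G| == l))
     avoid #|odd_triangles G| <= expR (k%:R * (404 - L / 40)).
Proof.
move=> nk lk; set h := (2 * k %/ D)%N.
(* The high vertices number at most [h <= 200 * k / n], so the edges that are not low cost only
   [expR (400 * k)]. *)
have hk : 2 * n%:R * h%:R <= 400 * k%:R :> R.
  rewrite -!natrM ler_nat; have : (h * D <= 2 * k)%N := leq_divM _ _.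
  have : (n <= 100 * D)%N by lia.
  nia.
have Ck := bin_edges_le l.
have cnt : (#|[pred G : {set {set 'I_n}} |
      (obstruction G && (#|G| == k)) && (#|low D G| == l)]|%:R : R)
    <= expR (400 * k%:R) * 'C('C(n, 2), l)%:R.
  apply: (@le_trans _ _ (expR (2 * n%:R * h%:R) * 'C('C(n, 2), l)%:R)); last first.
    by rewrite ler_wpM2r ?expR_mono.
  apply: le_trans (card_profile_le h l); rewrite ler_nat; apply: subset_leq_card.
  apply/fintype.subsetP=> G; rewrite unfold_in => /andP[/andP[/and4P[sG _ _ _] /eqP Gk] lG].
  rewrite finset.inE sG lG /= /h leq_divRL; last by lia.
  by rewrite mulnC -Gk card_high.
have k0 : 0 <= k%:R :> R by [].
have l0 : 0 <= l%:R :> R by [].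
have Lk := mulr_ge0 L_ge0 k0; have Ll := mulr_ge0 L_ge0 l0.
(* For [l <= 3 k / 10] the coefficient of [L * k] is at most 2 * 3/10 - 5/8 = -1/40, the source of
   the rate. *)
have [l_small|l_big] := leqP (10 * l) (3 * k).
  have W (G : {set {set 'I_n}}) : (obstruction G && (#|G| == k)) && (#|low D G| == l) ->
      avoid #|odd_triangles G| <= expR (- (5 / 8 * L * k%:R)).
    by case/andP=> /andP[oG /eqP <-] _; apply: avoid_obstruction.
  apply: le_trans (sum_le_card W) _; apply: le_trans (ler_wpM2r (expR_ge0 _) cnt) _.
  have C2 : 'C('C(n, 2), l)%:R <= expR (2 * L * l%:R) :> R.
    by apply: le_trans Ck; rewrite ler_peMr // ler1n fact_gt0.
  apply: le_trans (ler_wpM2r (expR_ge0 _) (ler_wpM2l (expR_ge0 _) C2)) _.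
  rewrite -!expRD; apply: expR_mono.
  have : L * (10 * l%:R) <= L * (3 * k%:R).
    by rewrite ler_wpM2l // -!natrM ler_nat.
  lra.
have W (G : {set {set 'I_n}}) : (obstruction G && (#|G| == k)) && (#|low D G| == l) ->
    avoid #|odd_triangles G| <= expR (- (9 / 5 * L * l%:R)).
  by case/andP=> /andP[/and4P[sG _ _ _] _] /eqP <-; apply: avoid_low.
apply: le_trans (sum_le_card W) _; apply: le_trans (ler_wpM2r (expR_ge0 _) cnt) _.
have kL : expR (L / 2) <= k%:R :> R.
  rewrite -(@ler_pXn2r _ 2) ?nnegrE ?expR_ge0 // -expRM_natl.
  rewrite (_ : 2%:R * (L / 2) = L); last by field.
  by rewrite -nE -natrX ler_nat -mulnn ltnW.
(* Now [l] is nearly the square root of [n], so [l!] saves almost [L / 2] per low edge, leaving 3/2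
   against 9/5. *)
have lL : expR (L / 2 - 3) <= l%:R :> R.
  have e3 : 10 / 3 <= expR 3 :> R.
    by have := @expR_ge1Dxn R 3 1 (ler0n _ 3); rewrite (_ : 2`!%:R = 2 :> R) //; lra.
  rewrite expRD expRN ler_pdivrMr ?expR_gt0 //; apply: le_trans kL _.
  have : 3 * k%:R <= 10 * l%:R :> R by rewrite -!natrM ler_nat ltnW.
  have : l%:R * (10 / 3) <= l%:R * expR 3 :> R by rewrite ler_wpM2l.
  lra.
have C2 : 'C('C(n, 2), l)%:R <= expR ((3 / 2 * L + 4) * l%:R) :> R.
  rewrite (_ : (3 / 2 * L + 4) * l%:R =
               2 * L * l%:R + l%:R - l%:R * (L / 2 - 3)); last by field.
  rewrite expRD expRN ler_pdivlMr ?expR_gt0 // expRD.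
  apply: le_trans (ler_wpM2r (expR_ge0 _) Ck).
  rewrite -mulrA ler_wpM2l //; apply: le_trans (pow_self_le R l).
  by rewrite expRM_natl lerXn2r ?nnegrE ?expR_ge0.
apply: le_trans (ler_wpM2r (expR_ge0 _) (ler_wpM2l (expR_ge0 _) C2)) _.
rewrite -!expRD; apply: expR_mono.
have : L * (3 * k%:R) <= L * (10 * l%:R).
  by rewrite ler_wpM2l // -!natrM ler_nat ltnW.
have : l%:R <= k%:R :> R by rewrite ler_nat.
lra.
Qed.

(** The [k.+1] possible values of [l] cost a factor [expR k], which raises 404 to 405. *)
Lemma sum_large_obstructions k : (n < k * k)%N ->
  \sum_(G : {set {set 'I_n}} | obstruction G && (#|G| == k)) avoid #|odd_triangles G|
  <= expR (k%:R * (405 - L / 40)).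
Proof.
move=> nk; rewrite (@sum_by_nat _ _ _ (fun G => #|low D G|) _ k); last first.
  move=> G /andP[_ /eqP <-]; apply: subset_leq_card.
  by apply/fintype.subsetP=> e; rewrite finset.inE => /andP[].
have lek (l : 'I_k.+1) : true -> \sum_(G : {set {set 'I_n}} |
    obstruction G && (#|G| == k) && (#|low D G| == l)) avoid #|odd_triangles G|
    <= expR (k%:R * (404 - L / 40)).
  by move=> _; apply: sum_profile => //; rewrite -ltnS.
apply: le_trans (ler_sum _ lek) _.
rewrite sumr_const card_ord -[leLHS]mulr_natl.
rewrite (_ : k%:R * (405 - L / 40) = k%:R + k%:R * (404 - L / 40)); last by ring.
by rewrite expRD ler_wpM2r ?expR_ge0 // -natr1 addrC expR_ge1Dx.
Qed.

Lemma geometric_tail (r : R) m : 0 <= r -> r <= 2^-1 -> \sum_(k < m) r ^+ k.+2 <= r.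
Proof.
(* The subtracted term makes the bound inductive. *)
move=> r0 r2; suff : \sum_(k < m) r ^+ k.+2 <= 2 * r ^+ 2 - 2 * r ^+ m.+2.
  have : 0 <= r ^+ m.+2 by rewrite exprn_ge0.
  have : r ^+ 2 <= r * 2^-1 by rewrite expr2 ler_wpM2l.
  lra.
elim: m => [|m IHm]; first by rewrite big_ord0 subrr.
rewrite big_ord_recr /=; have : r ^+ m.+3 <= r ^+ m.+2 * 2^-1.
  by rewrite [_ ^+ m.+3]exprSr ler_wpM2l ?exprn_ge0.
lra.
Qed.

Lemma prob_obstruction : (M <= N)%N -> 405 - L / 40 <= -1 ->
  prob R (fun w : outcome n =>
    [exists G, obstruction G && [disjoint added w M & odd_triangles G]])
  <= expR (405 - L / 40).
Proof.
move=> leM Lbig; apply: le_trans (@prob_exists R n _ (@obstruction n)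
  (fun G w => [disjoint added w M & odd_triangles G])) _.
under eq_bigr => G _ do rewrite prob_avoid //.
(* The bound is one more than the maximal size so that two terms can be split off; these, for sizes
   0 and 1, are empty sums. *)
rewrite (@sum_by_nat _ _ _ (fun G : {set {set 'I_n}} => #|G|) _ #|edges n|.+1); last first.
  by move=> G /and4P[sG _ _ _]; apply: leqW; apply: subset_leq_card.
set r := expR _.
have r2 : r <= 2^-1.
  have two : 2 <= expR 1 :> R by have := expR_ge1Dx (1 : R); lra.
  rewrite -[2^-1]invrK invrK; apply: (@le_trans _ _ (expR (-1))); first exact: expR_mono.
  by rewrite expRN lef_pV2 ?posrE ?expR_gt0.
rewrite !big_ord_recl [X in X + _]big1 ?add0r; last first.
  by move=> G /andP[/and4P[_ + _ _] /eqP E]; rewrite E.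
rewrite [X in X + _]big1 ?add0r; last first.
  by move=> G /andP[/and4P[_ + _ _] /eqP E]; rewrite E.
apply: le_trans (@geometric_tail r #|edges n| (expR_ge0 _) r2); apply: ler_sum => k _.
rewrite -expRM_natl /= /bump /= !add1n; have [le|lt] := leqP (k.+2 * k.+2) n.
  exact: sum_small_obstructions.
exact: sum_large_obstructions.
Qed.

End UnionBound.

(** * The threshold *)

Section Threshold.
Import Order.TTheory GRing.Theory Num.Theory.
Local Open Scope ring_scope.

Lemma bernoulli_le (R : realDomainType) (t : R) n : 0 <= t -> t <= 1 ->
  1 - n%:R * t <= (1 - t) ^+ n.
Proof.
move=> t0 t1; elim: n => [|n IHn]; first by rewrite expr0 mul0r subr0.
have u0 : 0 <= 1 - t by rewrite subr_ge0.
rewrite exprS; apply: le_trans (ler_wpM2l u0 IHn).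
have : 0 <= n%:R * (t * t) by rewrite !mulr_ge0.
by rewrite -natr1; nra.
Qed.

Lemma bin3_ge n : (100 * 103 <= n)%N -> (4 * (n * n.+1) <= 'C(n, 3))%N.
Proof.
move=> n_large; have : ('C(n, 3) * 6 = n * n.-1 * n.-2)%N.
  by rewrite -[6%N]/(3`!) bin_ffact !ffactnS ffactn0 muln1 mulnA.
have : (24 * n.+1 <= n.-1 * n.-2)%N by nia.
nia.
Qed.

Lemma sqr_le_bin2 n : (1 < n)%N -> (n ^ 2 <= 4 * 'C(n, 2))%N.
Proof.
move=> n1; have : ('C(n, 2) * 2 = n * n.-1)%N.
  by rewrite -[2%N]/(2`!) bin_ffact ffactnS ffactn1.
have : (n * n <= n * (2 * n.-1))%N by rewrite leq_mul2l; apply/orP; right; lia.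
by rewrite -mulnn; lia.
Qed.

Variables (R : realType) (n : nat) (L : R).
Hypothesis nE : n%:R = expR L.
Hypothesis n_large : (100 * 103 <= n)%N.
Notation N := ('C(n, 3)).
Notation rho := (avoid_ratio R N).

Let L_gt0 : 0 < L.
Proof. by rewrite -ltr_expR expR0 -nE ltr1n; lia. Qed.

Let N_gt0 : 0 < N%:R :> R.
Proof. by rewrite ltr0n bin_gt0; lia. Qed.

(** [M] is the first time satisfying the upper bound. It is not 0, where the density is 1, and one
    step earlier the density was larger by [1 / N]. *)
Lemma exists_threshold : exists2 M, (M <= N)%N &
  rho M 0 ^+ n <= expR (- (15 / 8 * L)) < (rho M 0 + N%:R^-1) ^+ n.
Proof.
pose P M := rho M 0 ^+ n <= expR (- (15 / 8 * L)).
have PN : P N.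
  rewrite /P /avoid_ratio subnn mul0r expr0n (_ : (n == 0)%N = false) ?expR_ge0 //; lia.
have exP : exists M, P M by exists N.
case: (ex_minnP exP) => M PM minM; have MN := minM N PN; exists M => //.
apply/andP; split=> //; case: M => [|M] in PM minM MN *.
  move: PM; rewrite /P /avoid_ratio !subn0 divff ?gt_eqF // expr1n leNgt.
  by rewrite -[X in _ < X]expR0 ltr_expR oppr_lt0 mulr_gt0.
have : ~~ P M by apply/negP=> /minM; rewrite ltnn.
rewrite /P -ltNge; suff -> : rho M 0 = rho M.+1 0 + N%:R^-1 by [].
rewrite /avoid_ratio !subn0 -[X in _ + X]mul1r -mulrDl natr1; congr (_%:R / _).
by lia.
Qed.

(** The density [y] one step earlier is at least 3/4, and the ratios up to index [n] are at least
    [y - d] with [n * d <= 1 / 4]; Bernoulli's inequality then loses at most half of [y ^+ n]. *)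
Lemma threshold_lower M : (M <= N)%N ->
  expR (- (15 / 8 * L)) < (rho M 0 + N%:R^-1) ^+ n ->
  4^-1 <= rho M n /\ expR (- (15 / 8 * L)) / 2 <= avoid R N M (n - 2).
Proof.
move=> MN; set y := rho M 0 + _ => yL.
have n0 : (0 < n)%N by lia.
have n0' : 0 < n%:R :> R by rewrite ltr0n.
have y0 : 0 <= y by rewrite addr_ge0 ?ratio_ge0 ?invr_ge0 // divr_ge0.
(* From [n >= 1 + L ^ 2 / 2], [10 * L <= L ^ 2 / 4 + 100] and the size of [n]. *)
have Ln : 10 * L <= n%:R.
  have n_ge : 100 * 103 <= n%:R :> R by rewrite -natrM ler_nat.
  have := @expR_ge1Dxn R L 1 (ltW L_gt0); rewrite -nE (_ : 2`!%:R = 2 :> R) //.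
  have := sqr_ge0 (L / 2 - 10); rewrite !expr2; move: n_ge; nra.
have y34 : 3 / 4 <= y.
  have : expR (- (15 / 8 * (L / n%:R))) <= y.
    rewrite -(ler_pXn2r n0) ?nnegrE ?expR_ge0 // -expRM_natl.
    apply/ltW; apply: le_lt_trans yL; rewrite ler_expR.
    by rewrite le_eqVlt; apply/orP; left; apply/eqP; field; rewrite gt_eqF.
  apply: le_trans; apply: le_trans (expR_ge1Dx _).
  have : L / n%:R <= 10^-1 by rewrite ler_pdivrMr //; lra.
  lra.
(* The loss is [n / N] from the index and [1 / N] from the single step. *)
pose d : R := n.+1%:R / N%:R.
have nd : n%:R * d <= 4^-1.
  rewrite /d mulrA ler_pdivrMr // ler_pdivlMl // -!natrM ler_nat; exact: bin3_ge.
have d0 : 0 <= d by rewrite divr_ge0.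
have nat_sub (a b : nat) : a%:R - b%:R <= (a - b)%N%:R :> R.
  by rewrite lerBlDr -natrD ler_nat; lia.
have ryd : y - d <= rho M n.
  have nN : (n < N)%N by have := bin3_ge n_large; nia.
  apply: (@le_trans _ _ ((N - M - n)%N%:R / N%:R)).
    rewrite /y /d /avoid_ratio !subn0 -natr1 -[X in _ + X - _]mul1r -mulrDl -mulrBl.
    rewrite ler_wpM2r ?invr_ge0 //; apply: le_trans (nat_sub _ _); lra.
  rewrite /avoid_ratio ler_wpM2l // lef_pV2 ?posrE // ?ltr0n ?subn_gt0 //.
  by rewrite ler_nat leq_subr.
have d14 : d <= 4^-1 by apply: le_trans nd; rewrite ler_peMl // ler1n.
split; first by lra.
apply: le_trans (avoid_ge_expr _ _ _ _).
apply: (@le_trans _ _ (rho M n ^+ n)); last first.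
  apply: (@le_trans _ _ (rho M n ^+ (n - 2))).
    by rewrite ler_wiXn2l ?leq_subr ?ratio_ge0 ?ratio_le1.
  by rewrite lerXn2r ?nnegrE ?ratio_ge0 // ratio_antitone ?leq_subr.
have y_gt0 : 0 < y by lra.
have yd : y - d = y * (1 - d / y) by field; rewrite gt_eqF.
have t0 : 0 <= d / y by rewrite divr_ge0.
have t1 : d / y <= 1 by rewrite ler_pdivrMr //; lra.
apply: (@le_trans _ _ ((y - d) ^+ n)); last first.
  by rewrite lerXn2r ?nnegrE ?ratio_ge0 //; lra.
rewrite yd exprMn; apply: ler_pM; rewrite ?expR_ge0 ?invr_ge0 //; first exact: ltW.
apply: le_trans (bernoulli_le n t0 t1).
have : n%:R * (d / y) <= 2^-1 by rewrite mulrA ler_pdivrMr //; lra.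
lra.
Qed.

(** The mean number of isolated edges is at least [expR (L / 8) / 8], because 2 - 15/8 = 1/8. All
    errors are weakened to the rate [expR (- (L / 40))], with constants 8 and 32 from the second
    moment. *)
Lemma prob_neq_le : 405 - L / 40 <= -1 ->
  prob R (fun w : outcome n => M1 w != M3 w) <= (40 + expR 405) * expR (- (L / 40)).
Proof.
move=> Lbig; have [M MN /andP[upM loM]] := exists_threshold.
have [r4 qlow] := threshold_lower MN loM.
have n2 : (2 < n)%N by lia.
have no_iso := prob_no_isolated n2 MN r4.
have obs := prob_obstruction nE n_large upM MN Lbig.
have split_event : prob R (fun w : outcome n => M1 w != M3 w) <=
    prob R (fun w : outcome n => [forall e in edges n, ~~ [disjoint added w M & cofaces e]])
    + prob R (fun w : outcome n =>
        [exists G, obstruction G && [disjoint added w M & odd_triangles G]]).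
  apply: le_trans (prob_setU _ _ _); apply: prob_le => w /(M1_neq_M3 M n2)[->//|[G oG dG]].
  by apply/orP; right; apply/existsP; exists G; rewrite oG.
apply: le_trans split_event _; apply: le_trans (lerD no_iso obs) _.
have K4 : expR (2 * L) / 4 <= 'C(n, 2)%:R.
  rewrite ler_pdivrMr // expRM_natl -nE -natrX -natrM ler_nat.
  by rewrite mulnC sqr_le_bin2 //; apply: ltnW.
have e8 : 8^-1 * expR (L / 40) <= 'C(n, 2)%:R * avoid R N M (n - 2).
  apply: (@le_trans _ _ ((expR (2 * L) / 4) * (expR (- (15 / 8 * L)) / 2))); last first.
    by apply: ler_pM => //; rewrite divr_ge0 ?expR_ge0.
  rewrite mulrACA -expRD mulrC ler_pM ?expR_ge0 ?ler_expR //; first by move: L_gt0; lra.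
  by rewrite -invfM lef_pV2 ?posrE //; lra.
have i8 : ('C(n, 2)%:R * avoid R N M (n - 2))^-1 <= 8 * expR (- (L / 40)).
  have e8_gt0 : 0 < 8^-1 * expR (L / 40) by rewrite mulr_gt0 ?expR_gt0.
  rewrite expRN -[8]invrK -invfM lef_pV2 ?posrE //; exact: lt_le_trans e8_gt0 e8.
have i32 : (8 * n)%:R / 'C(n, 2)%:R <= 32 * expR (- (L / 40)) :> R.
  rewrite ler_pdivrMr; last by apply: lt_le_trans K4; rewrite divr_gt0 ?expR_gt0.
  apply: (@le_trans _ _ (32 * expR (- (L / 40)) * (expR (2 * L) / 4))); last first.
    by rewrite ler_wpM2l // mulr_ge0 ?expR_ge0.
  rewrite natrM nE; have : expR L <= expR (- (L / 40)) * expR (2 * L).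
    by rewrite -expRD ler_expR; move: L_gt0; lra.
  by have := expR_ge0 L; lra.
rewrite mulrDl -expRD; lra.
Qed.

End Threshold.

(** * Passage to the limit *)

Import Order.TTheory GRing.Theory Num.Theory.
Import numFieldNormedType.Exports.
Local Open Scope classical_set_scope.
Local Open Scope ring_scope.

Theorem theorem1p11 (R : realType) :
  (fun n : nat => prob R (fun w : outcome n => M1 w == M3 w)) @ \oo --> (1 : R).
Proof.
apply/cvgrPdist_le => eps eps0.
pose C : R := 40 + expR 405; have C0 : 0 < C by rewrite addr_gt0 ?expR_gt0.
near=> n.
have n_large : (100 * 103 <= n)%N by near: n; exists (100 * 103)%N.
have n0 : 0 < n%:R :> R by rewrite ltr0n; lia.
have nE : n%:R = expR (ln n%:R) :> R by rewrite lnK ?posrE.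
(* This bound gives [405 - L / 40 <= -1] for [L = ln n]; the next one makes the error at most
   [eps]. *)
have L1 : 405 * 40 + 40 <= ln n%:R :> R.
  by rewrite -ler_expR -nE; near: n; apply: nbhs_infty_ger.
have L2 : 40 * (ln C - ln eps) <= ln n%:R.
  by rewrite -ler_expR -nE; near: n; apply: nbhs_infty_ger.
rewrite -probC ger0_norm ?prob_ge0 //.
apply: le_trans (prob_neq_le nE n_large _) _; first lra.
rewrite -/C -(lnK (_ : C \is Num.pos)) ?posrE // -[leRHS]lnK ?posrE //.
by rewrite -expRD ler_expR; lra.
Unshelve. all: by end_near.
Qed.
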